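(* Let $p$ be a prime with $p \equiv 1,5,7,11,13,17,19$ or $23 \pmod{24}$, and let $f_\alpha \in \mathbb{F}_p[[t]]$ be the reduction modulo $p$ of the generating series $\sum_{n\ge 0}\alpha_n t^n$ of the Apéry numbers $\alpha_n=\sum_{k=0}^n\binom{n}{k}^2\binom{n+k}{n}^2$. Let $S\subset\mathbb{F}_p^\times$ be the subgroup of squares (the unique subgroup of index $2$). Then the image of the injective group homomorphism $$\mathrm{Gal}(\mathbb{F}_p(t,f_\alpha)/\mathbb{F}_p(t))\to\mathbb{F}_p^\times,\qquad \sigma\mapsto \sigma(f_\alpha)/f_\alpha$$ is: - $S$ if $p \equiv 1,5,7,11 \pmod{24}$; - all of $\mathbb{F}_p^\times$ if $p\equiv 13,17,19,23 \pmod{24}$.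
   Context: $\mathbb{F}_p(t,f_\alpha)$ denotes the subfield of $\mathbb{F}_p((t))$ generated over $\mathbb{F}_p(t)$ by $f_\alpha$. Setting $A_p=\sum_{n=0}^{p-1}\alpha_n t^n\in\mathbb{F}_p[t]$, one has the congruence $f_\alpha = A_p f_\alpha^p$ in $\mathbb{F}_p[[t]]$, so $f_\alpha^{p-1}=A_p^{-1}$; thus $\mathbb{F}_p(t,f_\alpha)/\mathbb{F}_p(t)$ is a Kummer (cyclic Galois) extension and the displayed map $\sigma\mapsto\sigma(f_\alpha)/f_\alpha$ is an injective group homomorphism into $\mathbb{F}_p^\times$. *)

(* Defs.v *)
From HB Require Import structures.
From mathcomp Require Import all_boot all_order all_algebra all_fingroup.
From mathcomp Require Import boolp classical_sets.

Set Implicit Arguments.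
Unset Strict Implicit.
Unset Printing Implicit Defensive.

Import GRing.Theory.
Local Open Scope ring_scope.

(** Formal power series. The record keeps the Cauchy product apart from the
pointwise operations on functions. *)
Record powser (R : Type) := PowSer { pscoef : nat -> R }.

Lemma powserP (R : Type) (x y : powser R) : pscoef x =1 pscoef y -> x = y.
Proof. by case: x y => [f] [g] /= /funext ->. Qed.

HB.instance Definition _ (R : Type) := gen_eqMixin (powser R).
HB.instance Definition _ (R : Type) := gen_choiceMixin (powser R).

Section PowSerRing.
Variable R : comNzRingType.
Implicit Types x y z : powser R.

Definition psC (c : R) : powser R :=
  PowSer (fun n => if n == 0%N then c else 0).
Definition psX : powser R := PowSer (fun n => (n == 1%N)%:R).
Definition psadd x y : powser R := PowSer (fun n => pscoef x n + pscoef y n).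
Definition psopp x : powser R := PowSer (fun n => - pscoef x n).
Definition psmul x y : powser R :=
  PowSer (fun n => \sum_(i < n.+1) pscoef x i * pscoef y (n - i)).

Lemma psaddA : associative psadd.
Proof. by move=> x y z; apply: powserP => n /=; rewrite addrA. Qed.
Lemma psaddC : commutative psadd.
Proof. by move=> x y; apply: powserP => n /=; rewrite addrC. Qed.
Lemma psadd0 : left_id (psC 0) psadd.
Proof. by move=> x; apply: powserP => n /=; rewrite if_same add0r. Qed.
Lemma psaddN : left_inverse (psC 0) psopp psadd.
Proof. by move=> x; apply: powserP => n /=; rewrite addNr if_same. Qed.

HB.instance Definition _ :=
  GRing.isZmodule.Build (powser R) psaddA psaddC psadd0 psaddN.

Let trunc N x : {poly R} := \poly_(i < N) pscoef x i.

Let coef_psmul N x y n : (n < N)%N ->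
  pscoef (psmul x y) n = (trunc N x * trunc N y)`_n.
Proof.
move=> nN; rewrite coefM /=; apply: eq_bigr => i _.
have iN : (i < N)%N by apply: leq_trans nN; rewrite ltn_ord.
by rewrite !coef_poly iN (leq_ltn_trans (leq_subr _ _) nN).
Qed.

Let coef_trunc N x n : (n < N)%N -> (trunc N x)`_n = pscoef x n.
Proof. by move=> nN; rewrite coef_poly nN. Qed.

Let psmulE x y n :
  pscoef (psmul x y) n = \sum_(i < n.+1) pscoef x i * pscoef y (n - i).
Proof. by []. Qed.

Lemma psmulA : associative psmul.
Proof.
move=> x y z; apply: powserP => n; rewrite !psmulE.
transitivity (trunc n.+1 x * (trunc n.+1 y * trunc n.+1 z))`_n.
  rewrite coefM; apply: eq_bigr => i _; rewrite coef_trunc//.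
  by rewrite (@coef_psmul n.+1)// ltnS leq_subr.
rewrite mulrA coefM; apply: eq_bigr => i _.
by rewrite (@coef_psmul n.+1)// coef_trunc// ltnS leq_subr.
Qed.

Lemma psmulC : commutative psmul.
Proof.
by move=> x y; apply: powserP => n; rewrite !(@coef_psmul n.+1)// mulrC.
Qed.

Lemma psmul1 : left_id (psC 1) psmul.
Proof.
move=> x; apply: powserP => n /=; rewrite big_ord_recl/= subn0 mul1r.
by rewrite big1 ?addr0// => i _; rewrite mul0r.
Qed.

Lemma psmulDl : left_distributive psmul psadd.
Proof.
move=> x y z; apply: powserP => n /=; rewrite -big_split/=.
by apply: eq_bigr => i _; rewrite mulrDl.
Qed.

Lemma psone_neq0 : psC 1 != 0.
Proof.
apply/eqP => /(congr1 (fun x => pscoef x 0%N)) /= /eqP.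
by rewrite oner_eq0.
Qed.

HB.instance Definition _ := GRing.Zmodule_isComNzRing.Build (powser R)
  psmulA psmulC psmul1 psmulDl psone_neq0.

Definition psunit : pred (powser R) := fun x => `[< exists y, y * x = 1 >].
Definition psinv x : powser R :=
  if pselect (exists y, y * x = 1) is left h then projT1 (cid h) else x.

Lemma psmulV : {in psunit, left_inverse 1 psinv *%R}.
Proof.
move=> x /asboolP xu; rewrite /psinv; case: pselect => // h.
by case: (cid h).
Qed.
Lemma psunitP x y : y * x = 1 -> x \in psunit.
Proof. by move=> yx; apply/asboolP; exists y. Qed.
Lemma psinv_out : {in [predC psunit], psinv =1 id}.
Proof.
move=> x /negP xu; rewrite /psinv; case: pselect => // h.
by exfalso; apply: xu; apply/asboolP.
Qed.

HB.instance Definition _ :=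
  GRing.ComNzRing_hasMulInverse.Build (powser R) psmulV psunitP psinv_out.

End PowSerRing.

Section PowSerIdomain.
Variable R : idomainType.

Let ps_order (x : powser R) : x != 0 ->
  exists2 m, pscoef x m != 0 & forall i, (i < m)%N -> pscoef x i = 0.
Proof.
move=> x0.
have ex : exists n, pscoef x n != 0.
  apply: contrapT => h; move/negP: x0; apply; apply/eqP/powserP => n /=.
  by rewrite if_same; apply: contrapT => /eqP xn; apply: h; exists n.
case: (ex_minnP ex) => m xm mmin; exists m => // i im.
by apply/eqP; apply: contraLR im => /mmin; rewrite -leqNgt.
Qed.

Lemma ps_integral (x y : powser R) : x * y = 0 -> (x == 0) || (y == 0).
Proof.
move=> xy; apply/norP => -[/ps_order[m xm xlt] /ps_order[n yn ylt]].
have /eqP : pscoef (x * y) (m + n) = 0 by rewrite xy /= if_same.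
have mmn : (m < (m + n).+1)%N by rewrite ltnS leq_addr.
rewrite /= (bigD1 (Ordinal mmn)) //= addKn big1 ?addr0.
  by rewrite mulf_eq0 (negPf xm) (negPf yn).
move=> i /eqP im; have [im'|mi|eim] := ltngtP i m.
- by rewrite xlt// mul0r.
- by rewrite ylt ?mulr0// ltn_subLR ?ltn_add2r// -ltnS ltn_ord.
- by case: im; apply: val_inj.
Qed.

HB.instance Definition _ :=
  GRing.ComUnitRing_isIntegral.Build (powser R) ps_integral.

End PowSerIdomain.

(** Over a field, the fraction field of the power series is the field of formal
Laurent series. *)
Definition laurent (F : fieldType) : fieldType := {fraction (powser F)}.

Definition ps_laurent (F : fieldType) (x : powser F) : laurent F :=
  FracField.tofrac x.

(** The intersection of all subfields of [L] containing [A]. A subset closed under the operations of [GRing.divring_closed]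
is a subfield: since [0^-1 = 0], closure under division by 0 is no
restriction. *)
Definition gen_subfield (L : fieldType) (A : set L) : pred L := fun x =>
  `[< forall S : {pred L}, GRing.divring_closed S ->
      (forall a, A a -> a \in S) -> x \in S >].

Section GenSubfield.
Variables (L : fieldType) (A : set L).

Lemma gen_subfield_closed : GRing.divring_closed (gen_subfield A).
Proof.
split.
- by apply/asboolP => S [].
- move=> x y /asboolP hx /asboolP hy; apply/asboolP => S SD SA.
  by case: (SD) => _ + _; apply; [exact: hx|exact: hy].
- move=> x y /asboolP hx /asboolP hy; apply/asboolP => S SD SA.
  by case: (SD) => _ _; apply; [exact: hx|exact: hy].
Qed.

HB.instance Definition _ :=
  GRing.isDivringClosed.Build L (gen_subfield A) gen_subfield_closed.

Lemma sub_gen_subfield a : A a -> a \in gen_subfield A.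
Proof. by move=> Aa; apply/asboolP => S _; apply. Qed.

Record gen_subfield_type := GenSubfield {
  gen_val :> L;
  gen_valP : gen_val \in gen_subfield A
}.

HB.instance Definition _ := [isSub for gen_val].
HB.instance Definition _ := [Choice of gen_subfield_type by <:].
HB.instance Definition _ :=
  [SubChoice_isSubComUnitRing of gen_subfield_type by <:].
HB.instance Definition _ :=
  [SubComUnitRing_isSubIntegralDomain of gen_subfield_type by <:].
HB.instance Definition _ :=
  [SubIntegralDomain_isSubField of gen_subfield_type by <:].

End GenSubfield.

(** The unit is preserved because [gal_mul] and [gal_bij] imply it. The group law
is composition. *)
Record gal (E : fieldType) (K : {pred E}) := Gal {
  gal_fun :> E -> E;
  gal_add : {morph gal_fun : x y / x + y};
  gal_mul : {morph gal_fun : x y / x * y};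
  gal_bij : bijective gal_fun;
  gal_fix : {in K, forall x, gal_fun x = x}
}.

HB.instance Definition _ E K := gen_eqMixin (@gal E K).
HB.instance Definition _ E K := gen_choiceMixin (@gal E K).

Section Gal.
Variables (E : fieldType) (K : {pred E}).
Implicit Types s t : gal K.

Lemma galP s t : s =1 t -> s = t.
Proof.
case: s t => [f fa fm fb ff] [g ga gm gb gf] /= /funext fg.
by subst g; congr Gal; exact: Prop_irrelevance.
Qed.

Definition gal1 : gal K.
Proof. by apply: (@Gal E K id) => //; exists id. Defined.

Definition gal_comp s t : gal K.
Proof.
apply: (@Gal E K (s \o t)).
- by move=> x y /=; rewrite !gal_add.
- by move=> x y /=; rewrite !gal_mul.
- by apply: bij_comp; exact: gal_bij.
- by move=> x Kx /=; rewrite !gal_fix.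
Defined.

Let gal_inv_ex s : exists t : gal K, cancel s t /\ cancel t s.
Proof.
case: (gal_bij s) => g sg gs.
have ga : {morph g : x y / x + y}.
  by move=> x y; rewrite -{1}(gs x) -{1}(gs y) -gal_add sg.
have gm : {morph g : x y / x * y}.
  by move=> x y; rewrite -{1}(gs x) -{1}(gs y) -gal_mul sg.
have gb : bijective g by exists s.
have gf : {in K, forall x, g x = x}.
  by move=> x Kx; rewrite -{1}(gal_fix s Kx) sg.
by exists (Gal ga gm gb gf).
Qed.

Definition gal_inv s : gal K := projT1 (cid (gal_inv_ex s)).

Lemma gal_compA : associative gal_comp.
Proof. by move=> s t u; apply: galP. Qed.
Lemma gal_comp1l : left_id gal1 gal_comp.
Proof. by move=> s; apply: galP. Qed.
Lemma gal_comp1r : right_id gal1 gal_comp.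
Proof. by move=> s; apply: galP. Qed.
Lemma gal_compVl : left_inverse gal1 gal_inv gal_comp.
Proof.
move=> s; apply: galP => x /=; rewrite /gal_inv.
by case: (cid _) => t [] /= st _; exact: st.
Qed.
Lemma gal_compVr : right_inverse gal1 gal_inv gal_comp.
Proof.
move=> s; apply: galP => x /=; rewrite /gal_inv.
by case: (cid _) => t [] /= _ ts; exact: ts.
Qed.

HB.instance Definition _ := isGroup.Build (gal K)
  gal_compA gal_comp1l gal_comp1r gal_compVl gal_compVr.

End Gal.

Definition apery (n : nat) : nat :=
  (\sum_(0 <= k < n.+1) 'C(n, k) ^ 2 * 'C(n + k, n) ^ 2)%N.

Section AperyModp.
Variable p : nat.

Definition apery_series : powser 'F_p := PowSer (fun n => (apery n)%:R).

Definition Fpt_const (c : 'F_p) : laurent 'F_p := ps_laurent (psC c).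

Definition Fpt_gens : set (laurent 'F_p) :=
  fun x => x = ps_laurent (psX 'F_p) \/ exists c, x = Fpt_const c.

(** F_p(t), as a subset of F_p((t)). *)
Definition Fpt : pred (laurent 'F_p) := gen_subfield Fpt_gens.

Definition Fptf_gens : set (laurent 'F_p) :=
  fun x => x \in Fpt \/ x = ps_laurent apery_series.

(** F_p(t, f_alpha), generated inside F_p((t)). *)
Definition Fptf : fieldType := gen_subfield_type Fptf_gens.

Definition f_alpha : Fptf :=
  GenSubfield (sub_gen_subfield (or_intror erefl : Fptf_gens _)).

Definition Fpt_in_Fptf : pred Fptf := fun x => (x : laurent 'F_p) \in Fpt.

Definition apery_gal := gal Fpt_in_Fptf.

HB.instance Definition _ := Group.on apery_gal.

End AperyModp.

(* Main.v *)
(** Write [A] for the truncation of the Apery series at degree [p - 1], so that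
[f ^ (p - 1) = 1 / A] by Lucas' congruence. If [f ^ d] lies in [F_p(t)] for a
divisor [d] of [p - 1], then [A] is an [(p - 1) / d]-th power of a polynomial, so
the image of the Galois group is governed by the exponents for which [A] is a
perfect power.

The third order Apery operator is a symmetric square, hence [f] satisfies a
quadratic differential equation (a first integral) over the integers; modulo [p]
the factor [f ^ p] is a constant of the derivation and [A] satisfies the same
equation. Reading it off at an irreducible factor of [A], that factor has
multiplicity 2 if it does not divide [D = 1 - 34 t + t^2], and 1 otherwise. Since
[deg A = p - 1] is even, [A = B ^ 2] or [A = D * B ^ 2], and [A] is not an [e]-th
power for [e > 2].

To separate the two cases, substitute [t = - z / ((1 - 8 z) (1 - 9 z))], which
makes [D] a square. Then a square root [G(z)] of [A], cleared of denominators, is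
a polynomial of degree at most [p - 1] killed by a second order operator, and so
is the truncated hypergeometric polynomial
[H(z) = sum_j (3j)!/j!^3 z^(2j) (1 - 8 z)^j (1 - 6 z)^(p-1-3j)];
as such a solution is determined by its value at 0, [G = H]. Comparing
coefficients of [z^(p-1)] gives [(-1)^(p %/ 3) = 2^((p-1)/2)] when [A = B ^ 2]
and the opposite sign when [A = D * B ^ 2]; the second supplement to quadratic
reciprocity finishes the computation modulo 24. *)

Require Import Defs.
From HB Require Import structures.
From mathcomp Require Import all_boot all_order all_algebra all_fingroup.
From mathcomp Require Import boolp classical_sets.
From mathcomp Require Import cyclic finfield zify ring.

Set Implicit Arguments.
Unset Strict Implicit.
Unset Printing Implicit Defensive.

Import GRing.Theory Num.Theory.
Local Open Scope ring_scope.

(** * The Apery recurrence *)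

Section AperyRecurrence.
Local Notation cc n k := (('C(n, k) * 'C(n + k, n))%N).

(** Terms with [k > n] vanish, so Apery numbers of different indices can share one summation
    range. *)
Lemma apery_widen (n M : nat) : (n < M)%N ->
  apery n = (\sum_(k < M) cc n k ^ 2)%N.
Proof.
move=> nM; rewrite /apery big_mkord.
rewrite (big_ord_widen M (fun k => ('C(n, k) ^ 2 * 'C(n + k, n) ^ 2)%N)) //.
rewrite big_mkcond /=; apply: eq_bigr => k _; case: ltnP => [_|nk].
  by rewrite expnMn.
by rewrite bin_small ?mul0n// -ltnS.
Qed.

Lemma apery_term_fact (n k : nat) : (k <= n)%N ->
  (cc n k * (k`! ^ 2 * (n - k)`!))%N = (n + k)`!.
Proof.
move=> kn.
have h1 := bin_fact kn.
have h2 : ('C(n + k, n) * (n`! * k`!))%N = (n + k)`!.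
  by move: (bin_fact (leq_addr k n)); rewrite addKn.
rewrite -h2 -h1; ring.
Qed.

Lemma apery_term_rat (n k : nat) : (k <= n)%N ->
  (cc n k)%:R = (n + k)`!%:R / (k`!%:R ^+ 2 * (n - k)`!%:R) :> rat.
Proof.
move=> kn; rewrite -(apery_term_fact kn) [in RHS]natrM [in RHS](natrM _ (_ ^ _)) natrX mulfK//.
by rewrite mulf_neq0 ?expf_neq0// pnatr_eq0 -lt0n fact_gt0.
Qed.

(** A common factor: the terms at [n], [n.+1], [n.+2] for [k], and the term at [n.+1] for [k - 1],
    are all polynomial multiples of [xx n k]. *)
Let xx n k : rat := (n + k)`!%:R / (k`!%:R ^+ 2 * (n.+2 - k)`!%:R).

Let factr_neq0 n : n`!%:R != 0 :> rat.
Proof. by rewrite pnatr_eq0 -lt0n fact_gt0. Qed.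

Let term0 n k : (k <= n.+2)%N ->
  (cc n k)%:R = xx n k * (n%:R + 1 - k%:R) * (n%:R + 2 - k%:R).
Proof.
move=> kn2; have [kn|nk] := leqP k n.
  rewrite apery_term_rat// /xx.
  have -> : (n.+2 - k = (n - k).+2)%N by lia.
  rewrite !factS !natrM -!natr1 natrB//.
  have h : (n - k)%:R + 1 + 1 != 0 :> rat by rewrite !natr1 pnatr_eq0.
  have h' : (n - k)%:R + 1 != 0 :> rat by rewrite !natr1 pnatr_eq0.
  move: h h'; rewrite natrB// => h h'.
  by field; rewrite !factr_neq0 h h'.
rewrite bin_small// mul0n.
have [->|->] : k = n.+1 \/ k = n.+2 by lia.
  by rewrite -natr1; ring.
by rewrite -!natr1; ring.
Qed.

Let term1 n k : (k <= n.+2)%N ->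
  (cc n.+1 k)%:R = xx n k * (n%:R + 1 + k%:R) * (n%:R + 2 - k%:R).
Proof.
move=> kn2; have [kn|nk] := leqP k n.+1.
  rewrite apery_term_rat// /xx.
  have -> : (n.+2 - k = (n.+1 - k).+1)%N by lia.
  rewrite addSn !factS !natrM -!natr1 natrB// natrD -natr1.
  have h : (n.+1 - k)%:R + 1 != 0 :> rat by rewrite !natr1 pnatr_eq0.
  move: h; rewrite natrB// -natr1 => h.
  by field; rewrite !factr_neq0 h.
rewrite bin_small// mul0n.
have -> : k = n.+2 by lia.
by rewrite -!natr1; ring.
Qed.

Let term2 n k : (k <= n.+2)%N ->
  (cc n.+2 k)%:R = xx n k * (n%:R + 1 + k%:R) * (n%:R + 2 + k%:R).
Proof.
move=> kn; rewrite apery_term_rat// /xx !addSn !factS !natrM -!natr1 natrD.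
by field; rewrite !factr_neq0.
Qed.

Let term1S n k : (k <= n.+1)%N -> (cc n.+1 k)%:R = xx n k.+1 * k.+1%:R ^+ 2.
Proof.
move=> kn; rewrite apery_term_rat// /xx addnS addSn subSS !factS !natrM.
have h : k.+1%:R != 0 :> rat by rewrite pnatr_eq0.
move: h; rewrite -natr1 => h.
by field; rewrite !factr_neq0 h.
Qed.

(** Creative telescoping in [k] over [rat]; the terms are arranged without subtraction so that the
    recurrence can be stated in [nat]. *)
Lemma apery_rec (n : nat) :
  (n.+2 ^ 3 * apery n.+2 + n.+1 ^ 3 * apery n =
   (34 * n.+1 ^ 3 + 51 * n.+1 ^ 2 + 27 * n.+1 + 5) * apery n.+1)%N.
Proof.
pose t (k : nat) : rat := n.+2%:R ^+ 3 * (cc n.+2 k)%:R ^+ 2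
  - (34%:R * n.+1%:R ^+ 3 + 51%:R * n.+1%:R ^+ 2 + 27%:R * n.+1%:R + 5%:R)
    * (cc n.+1 k)%:R ^+ 2
  + n.+1%:R ^+ 3 * (cc n k)%:R ^+ 2.
(* Zagier's telescoping certificate for the Apery recurrence *)
pose B (k : nat) : rat := 4%:R * (2 * n.+1 + 1)%:R *
   (k%:R * (2%:R * k%:R + 1) - (2 * n.+1 + 1)%:R ^+ 2) * (cc n.+1 k)%:R ^+ 2.
have tB j : (j <= n.+2)%N -> \sum_(k < j.+1) t k = B j.
  elim: j => [_|j IH jn].
    rewrite big_ord1 /t /B !bin0 !addn0 !binn !mul1n natrD natrM -!natr1.
    by ring.
  rewrite big_ord_recr /= IH; last by lia.
  rewrite /t /B (term0 jn) (term1 jn) (term2 jn) (term1S (k := j))//.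
  rewrite natrD natrM -!natr1; ring.
have : \sum_(k < n.+3) t k = 0.
  by rewrite tB// /B bin_small// mul0n mulr0.
rewrite !big_split/= -mulr_sumr sumrN -!mulr_sumr.
have S m : (m < n.+3)%N -> \sum_(k < n.+3) (cc m k)%:R ^+ 2 = (apery m)%:R :> rat.
  move=> mn; rewrite (apery_widen mn) natr_sum; apply: eq_bigr => k _.
  by rewrite natrX.
rewrite !S//; last by lia.
move=> /eqP; rewrite addrAC subr_eq0 => /eqP h.
apply/eqP; rewrite -(eqr_nat rat); apply/eqP.
by move: h; rewrite ?(natrD, natrM, natrX).
Qed.

End AperyRecurrence.

(** * Power series and the first integral *)

Section PowSerTheory.
Variable R : comNzRingType.
Implicit Types x y : powser R.

Lemma pscoefD x y n : pscoef (x + y) n = pscoef x n + pscoef y n.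
Proof. by []. Qed.

Lemma pscoefN x n : pscoef (- x) n = - pscoef x n.
Proof. by []. Qed.

Lemma pscoef0 n : pscoef (0 : powser R) n = 0.
Proof. by rewrite /= if_same. Qed.

Lemma pscoef_natM x m n : pscoef (m%:R * x) n = m%:R * pscoef x n.
Proof.
elim: m => [|m IH]; first by rewrite !mul0r pscoef0.
by rewrite -!natr1 !mulrDl !mul1r pscoefD IH.
Qed.

Lemma pscoefXM x n :
  pscoef (psX R * x) n = if n is m.+1 then pscoef x m else 0.
Proof.
rewrite /= big_ord_recl /= mul0r add0r.
case: n => [|n]; first by rewrite big_ord0.
rewrite big_ord_recl /= mul1r subSS subn0 big1 ?addr0// => i _.
by rewrite mul0r.
Qed.

Lemma pscoefXnM x k n :
  pscoef (psX R ^+ k * x) n = if (k <= n)%N then pscoef x (n - k) else 0.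
Proof.
elim: k n => [|k IH] n; first by rewrite mul1r subn0.
rewrite exprS -mulrA pscoefXM; case: n => [|n]; first by [].
by rewrite IH subSS.
Qed.

Definition pstheta x : powser R := PowSer (fun n => n%:R * pscoef x n).

Lemma psthetaD : {morph pstheta : x y / x + y}.
Proof. by move=> x y; apply: powserP => n /=; rewrite mulrDr. Qed.

Lemma psthetaN : {morph pstheta : x / - x}.
Proof. by move=> x; apply: powserP => n /=; rewrite mulrN. Qed.

Lemma psthetaM x y : pstheta (x * y) = pstheta x * y + x * pstheta y.
Proof.
apply: powserP => n /=; rewrite mulr_sumr -big_split /=.
apply: eq_bigr => i _.
have {1}-> : n = (i + (n - i))%N by rewrite subnKC// -ltnS.
rewrite natrD; ring.
Qed.

Lemma pstheta1 : pstheta 1 = 0.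
Proof. by apply: powserP => n /=; case: n => [|n]; rewrite ?mul0r ?mulr0. Qed.

Lemma pstheta_nat m : pstheta m%:R = 0.
Proof.
elim: m => [|m IH]; last by rewrite -natr1 psthetaD IH pstheta1 addr0.
by apply: powserP => n; rewrite /= if_same mulr0.
Qed.

Lemma psthetaX : pstheta (psX R) = psX R.
Proof.
apply: powserP => n /=; case: eqP => [->|]; first by rewrite mulr1.
by rewrite mulr0.
Qed.

Definition poly_ps (p : {poly R}) : powser R := PowSer (fun n => p`_n).

Lemma poly_ps_is_zmod_morphism : zmod_morphism poly_ps.
Proof. by move=> p q; apply: powserP => n /=; rewrite coefB. Qed.

Lemma poly_ps_is_monoid_morphism : monoid_morphism poly_ps.
Proof.
split=> [|p q]; apply: powserP => n /=; last by rewrite coefM.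
by rewrite coef1; case: eqP.
Qed.

HB.instance Definition _ := GRing.isZmodMorphism.Build {poly R} (powser R)
  poly_ps poly_ps_is_zmod_morphism.
HB.instance Definition _ := GRing.isMonoidMorphism.Build {poly R} (powser R)
  poly_ps poly_ps_is_monoid_morphism.

Lemma poly_ps_inj : injective poly_ps.
Proof.
by move=> p q pq; apply/polyP => i; have := congr1 (fun x => pscoef x i) pq.
Qed.

Lemma poly_psX : poly_ps 'X = psX R.
Proof. by apply: powserP => n /=; rewrite coefX. Qed.

Lemma poly_psC c : poly_ps c%:P = psC c.
Proof. by apply: powserP => n /=; rewrite coefC. Qed.

(** The Euler derivation [t d/dt], given by its coefficients so that it is not
convertible to a product: rewriting with [thetaM] would otherwise unfold it. *)
Definition theta (p : {poly R}) : {poly R} := \poly_(i < size p) (i%:R * p`_i).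

Lemma coef_theta p n : (theta p)`_n = n%:R * p`_n.
Proof. by rewrite coef_poly; case: ltnP => // /leq_sizeP->//; rewrite mulr0. Qed.

Lemma thetaE p : theta p = 'X * p^`().
Proof.
apply/polyP => -[|n]; rewrite coef_theta coefXM ?mul0r//.
by rewrite coef_deriv mulr_natl.
Qed.

Lemma thetaD : {morph theta : p q / p + q}.
Proof. by move=> p q; rewrite !thetaE derivD mulrDr. Qed.

Lemma thetaN : {morph theta : p / - p}.
Proof. by move=> p; rewrite !thetaE derivN mulrN. Qed.

Lemma thetaM p q : theta (p * q) = theta p * q + p * theta q.
Proof. rewrite !thetaE derivM; ring. Qed.

Lemma thetaX : theta 'X = 'X.
Proof. by rewrite thetaE derivX mulr1. Qed.

Lemma thetaC c : theta c%:P = 0.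
Proof. by rewrite thetaE derivC mulr0. Qed.

Lemma theta_nat m : theta m%:R = 0.
Proof. by rewrite -polyC_natr thetaC. Qed.

Lemma poly_ps_theta p : poly_ps (theta p) = pstheta (poly_ps p).
Proof. by apply: powserP => n /=; rewrite coef_theta. Qed.

End PowSerTheory.

Section PowSerMap.
Variables (R S : comNzRingType) (h : {rmorphism R -> S}).

Definition psmap (x : powser R) : powser S := PowSer (fun n => h (pscoef x n)).

Lemma psmap_is_zmod_morphism : zmod_morphism psmap.
Proof. by move=> x y; apply: powserP => n /=; rewrite rmorphB. Qed.

Lemma psmap_is_monoid_morphism : monoid_morphism psmap.
Proof.
split=> [|x y]; apply: powserP => n /=.
  by rewrite (fun_if h) rmorph1 rmorph0.
by rewrite rmorph_sum; apply: eq_bigr => i _; rewrite rmorphM.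
Qed.

HB.instance Definition _ := GRing.isZmodMorphism.Build (powser R) (powser S)
  psmap psmap_is_zmod_morphism.
HB.instance Definition _ := GRing.isMonoidMorphism.Build (powser R) (powser S)
  psmap psmap_is_monoid_morphism.

Lemma psmapX : psmap (psX R) = psX S.
Proof. by apply: powserP => n /=; rewrite rmorph_nat. Qed.

Lemma psmap_theta x : psmap (pstheta x) = pstheta (psmap x).
Proof. by apply: powserP => n /=; rewrite rmorphM rmorph_nat. Qed.

End PowSerMap.

Section FirstIntegral.
Variable R : comNzRingType.
Implicit Types t w : R.

Definition disc t : R := 1 - 34%:R * t + t ^+ 2.

(** The Apery operator is the symmetric square of a second order operator, so
it has a quadratic first integral; here [w1] and [w2] stand for the first and
second Euler derivatives of [w0]. *)
Definition apery_form t w0 w1 w2 : R :=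
  disc t * (2%:R * w0 * w2 - w1 ^+ 2) + (2%:R * t ^+ 2 - 34%:R * t) * w0 * w1
  + (t ^+ 2 - 10%:R * t) * w0 ^+ 2.

End FirstIntegral.

Lemma rmorph_apery_form (R S : comNzRingType) (h : {rmorphism R -> S})
  (t w0 w1 w2 : R) :
  h (apery_form t w0 w1 w2) = apery_form (h t) (h w0) (h w1) (h w2).
Proof.
by rewrite /apery_form /disc;
  rewrite ?(rmorphD, rmorphB, rmorphN, rmorphM, rmorphXn, rmorph1, rmorph_nat).
Qed.

(** The ring is arbitrary because the first integral is proved over the integers and then reduced
    modulo [p]. *)
Definition apery_ps (R : comNzRingType) : powser R :=
  PowSer (fun n => (apery n)%:R).

Lemma apery0 : apery 0 = 1%N.
Proof. by rewrite /apery big_nat1. Qed.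

Lemma apery1 : apery 1 = 5%N.
Proof. by rewrite /apery big_nat_recl// big_nat1. Qed.

(** The recurrence read coefficientwise. Coefficients 0 and 1 fall outside [apery_rec]; the latter
    uses the first two Apery numbers. *)
Lemma apery_ode (R : comNzRingType) (f := apery_ps R)
  (f1 := pstheta f) (f2 := pstheta f1) (f3 := pstheta f2) (t := psX R) :
  f3 - t * (34%:R * f3 + 51%:R * f2 + 27%:R * f1 + 5%:R * f)
  + t * (t * (f3 + 3%:R * f2 + 3%:R * f1 + f)) = 0.
Proof.
apply: powserP => n; rewrite pscoef0 !pscoefD pscoefN /t.
case: n => [|[|n]].
- by rewrite !pscoefXM /= !mul0r oppr0 !addr0.
- rewrite !pscoefXM !pscoefD !pscoef_natM /f3 /f2 /f1 /= apery1 apery0; ring.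
rewrite !pscoefXM !pscoefD !pscoef_natM /f3 /f2 /f1 /=.
have /(congr1 (fun m => m%:R : R)) := apery_rec n.
rewrite ?(natrD, natrM, natrX) => h.
apply/eqP; rewrite -subr_eq0.
rewrite -[X in _ == X](subrr
  (n.+2%:R ^+ 3 * (apery n.+2)%:R + n.+1%:R ^+ 3 * (apery n)%:R)).
rewrite {2}h -!natr1; apply/eqP; ring.
Qed.

(** The Euler derivative of the form is [2 f] times the Apery equation, so the coefficients of
    positive index vanish after division by the index, which requires characteristic zero. The
    constant coefficient vanishes because those of [t] and [pstheta f] do. *)
Lemma apery_form_int (f := apery_ps int) :
  apery_form (psX int) f (pstheta f) (pstheta (pstheta f)) = 0.
Proof.
set w := apery_form _ _ _ _.
have w0 : pstheta w = 0.
  have := apery_ode int; cbv zeta; rewrite -/f /w /apery_form /disc => ode.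
  rewrite !expr2 !(psthetaD, psthetaN, psthetaM, pstheta_nat, pstheta1, psthetaX).
  move: ode; set e := (X in X = _) => ode.
  by transitivity (2%:R * f * e); [rewrite /e; ring | rewrite ode mulr0].
apply: powserP => -[|n].
  rewrite /w /apery_form pscoef0 !pscoefD /= !big_ord1 /=.
  by rewrite !(mul0r, mulr0, addr0, subr0, oppr0) /= ?big_ord1 /=
    ?(mul0r, mulr0, addr0, subr0, oppr0).
have /eqP := congr1 (fun x => pscoef x n.+1) w0.
by rewrite pscoef0 /= mulf_eq0 pnatr_eq0 /= => /eqP.
Qed.

Lemma apery_form_ps (R : comNzRingType) (f := apery_ps R) :
  apery_form (psX R) f (pstheta f) (pstheta (pstheta f)) = 0.
Proof.
have h : psmap (intmul (1 : R)) (apery_ps int) = f.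
  by apply: powserP => n /=; rewrite rmorph_nat.
rewrite -h -!psmap_theta -(psmapX (intmul (1 : R))).
by rewrite -rmorph_apery_form apery_form_int rmorph0.
Qed.

(** * Lucas congruences *)

Lemma coef_exp1X (R : comNzRingType) N i :
  ((1 + 'X : {poly R}) ^+ N)`_i = 'C(N, i)%:R.
Proof.
rewrite exprDn coef_sum.
under eq_bigr => j _ do rewrite expr1n mul1r coefMn coefXn.
have [iN|Ni] := leqP i N.
  rewrite (bigD1 (Ordinal (iN : (i < N.+1)%N))) //= eqxx big1 ?addr0// => j ji.
  rewrite (_ : (i == j) = false) ?mul0rn//; apply/eqP => ij.
  by move/eqP: ji; apply; apply: val_inj.
rewrite bin_small// big1// => j _.
by rewrite (_ : (i == j) = false) ?mul0rn//; apply/eqP; have := ltn_ord j; lia.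
Qed.

Section Lucas.
Variables (p : nat) (p_prime : prime p).
Local Notation F := 'F_p.

Let p_gt0 : (0 < p)%N := prime_gt0 p_prime.

Lemma exprDp (R : comNzRingType) (x y : R) :
  p \in [pchar R] -> (x + y) ^+ p = x ^+ p + y ^+ p.
Proof. by move=> Rp; rewrite exprDn_pchar// pnatE. Qed.

Lemma pchar_polyF : p \in [pchar {poly F}].
Proof. by rewrite pchar_poly pchar_Fp. Qed.

Lemma exprpD1 : (1 + 'X) ^+ p = 1 + 'X^p :> {poly F}.
Proof.
by rewrite exprDp ?expr1n// pchar_polyF.
Qed.

(** Compares coefficients in [(1 + X)^(p + m) = (1 + X^p) (1 + X)^m]. *)
Lemma bin_addp m k :
  'C(p + m, k)%:R = 'C(m, k)%:R + (if (p <= k)%N then 'C(m, k - p)%:R else 0) :> F.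
Proof.
rewrite -!(coef_exp1X F) exprD exprpD1 mulrDl mul1r coefD coefXnM.
by case: ltnP => //; rewrite coef_exp1X.
Qed.

(** Lucas' theorem, by induction on [a]: [bin_addp] acts on the quotients [a] and [c] as Pascal's
    rule does. *)
Lemma bin_lucas a b c d : (b < p)%N -> (d < p)%N ->
  'C(p * a + b, p * c + d)%:R = 'C(a, c)%:R * 'C(b, d)%:R :> F.
Proof.
move=> bp dp; elim: a c => [|a IH] c.
  rewrite muln0 add0n; case: c => [|c]; first by rewrite muln0 bin0 mul1r.
  rewrite bin_small ?mul0r//; nia.
rewrite mulnS -addnA bin_addp; case: c => [|c].
  by rewrite IH !bin0 muln0 add0n leqNgt dp /= addr0.
rewrite IH binS natrD mulrDl.
have -> : (p <= p * c.+1 + d)%N by nia.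
have -> : (p * c.+1 + d - p = p * c + d)%N by nia.
by rewrite IH.
Qed.

Lemma big_ord_mul (V : nmodType) (m n : nat) (G : nat -> V) :
  \sum_(k < m * n) G k = \sum_(c < n) \sum_(d < m) G (m * c + d)%N.
Proof.
elim: n => [|n IH]; first by rewrite muln0 !big_ord0.
by rewrite mulnSr big_split_ord big_ord_recr /= IH.
Qed.

Lemma apery_lucas a b : (b < p)%N ->
  (apery (p * a + b))%:R = (apery a)%:R * (apery b)%:R :> F.
Proof.
move=> bp; rewrite (@apery_widen _ (p * a.+1)); last by rewrite mulnS; lia.
rewrite (@apery_widen a a.+1)// (@apery_widen b p)// !natr_sum.
rewrite (big_ord_mul _ _
  (fun k => (('C(p * a + b, k) * 'C(p * a + b + k, p * a + b)) ^ 2)%:R)).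
rewrite mulr_suml; apply: eq_bigr => -[c ca] _ /=.
rewrite mulr_sumr; apply: eq_bigr => -[d dp] _ /=.
rewrite !natrX -exprMn !natrM bin_lucas//; congr (_ ^+ 2).
rewrite -!mulrA; congr (_ * _); rewrite mulrCA; congr (_ * _).
have [bd|bd] := ltnP (b + d) p.
  have -> : (p * a + b + (p * c + d) = p * (a + c) + (b + d))%N by nia.
  by rewrite bin_lucas.
(* When [b + d] carries, the low digit [b + d - p] is less than [b], so both sides vanish. *)
have -> : (p * a + b + (p * c + d) = p * (a + c).+1 + (b + d - p))%N by nia.
have bdp : (b + d - p < p)%N by lia.
rewrite bin_lucas// (@bin_small (b + d - p)); last by lia.
have -> : (b + d = p * 1 + (b + d - p))%N by lia.
have {2}-> : b = (p * 0 + b)%N by rewrite muln0.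
by rewrite bin_lucas// (@bin_small (b + d - p)) ?mulr0//; lia.
Qed.

(** For [k > 0] the sum [p.-1 + k] carries and the term vanishes, leaving [k = 0]. This is the
    leading coefficient of [aperyp], so it fixes the degree. *)
Lemma apery_predp : (apery p.-1)%:R = 1 :> F.
Proof.
rewrite (@apery_widen _ p) ?prednK//.
rewrite natr_sum.
rewrite (bigD1 (Ordinal p_gt0)) //= bin0 addn0 binn /= big1 ?addr0// => -[k kp] /= k0.
have {}k0 : (0 < k)%N by rewrite lt0n; apply: contra_neq k0 => ?; apply: val_inj.
rewrite natrX natrM.
have -> : (p.-1 + k = p * 1 + k.-1)%N by lia.
have {2}-> : p.-1 = (p * 0 + p.-1)%N by rewrite muln0.
rewrite bin_lucas; [|lia..].
by rewrite (@bin_small k.-1) ?mulr0 ?expr0n//; lia.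
Qed.

Lemma pchar_powser : p \in [pchar powser F].
Proof.
rewrite inE p_prime /=; apply/eqP.
by rewrite -(rmorph_nat (@poly_ps F)) -polyC_natr (pcharf0 (pchar_Fp p_prime)) polyC0 rmorph0.
Qed.

Lemma Fp_fermat (c : F) : c ^+ p = c.
Proof. by rewrite -{2}(expf_card c) card_Fp. Qed.

Lemma poly_exprp (q : {poly F}) i :
  (q ^+ p)`_i = if (p %| i)%N then q`_(i %/ p) else 0.
Proof.
elim/poly_ind: q i => [|q c IH] i.
  by rewrite expr0n eqn0Ngt p_gt0 /= !coef0 if_same.
rewrite exprDp ?pchar_polyF//.
rewrite -polyC_exp Fp_fermat exprMn !coefD !coefC coefMXn coefMX.
case: ltnP => [ip|pi].
  case: i ip => [|i] ip; first by rewrite dvdn0 div0n.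
  by rewrite gtnNdvd// /= addr0.
rewrite -(subnKC pi) addKn IH dvdn_addr// divnDl// divnn p_gt0 addr0.
by rewrite (_ : (p + (i - p) == 0)%N = false) ?addr0//; lia.
Qed.

(** Reduced to polynomials by splitting off a tail divisible by [X^(n+1)], whose [p]-th power starts
    beyond index [n]. *)
Lemma ps_exprp (x : powser F) n :
  pscoef (x ^+ p) n = if (p %| n)%N then pscoef x (n %/ p) else 0.
Proof.
have [y xy] : exists y, x = poly_ps (\poly_(i < n.+1) pscoef x i) + psX F ^+ n.+1 * y.
  exists (PowSer (fun i => pscoef x (i + n.+1))).
  apply: powserP => i; rewrite pscoefD pscoefXnM /= coef_poly ltnS.
  by case: leqP => ni; rewrite ?addr0 ?add0r// subnK.
have p2 := prime_gt1 p_prime.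
rewrite {1}xy exprDp ?pchar_powser//.
rewrite exprMn -exprM pscoefD pscoefXnM -rmorphXn /= poly_exprp leqNgt.
rewrite (_ : (n < _)%N) ?addr0; last by nia.
by case: ifP => // _; rewrite coef_poly ltnS leq_div.
Qed.

(** The truncation [A_p] of the Apery series. *)
Definition aperyp : {poly F} := \poly_(i < p) (apery i)%:R.

(** A [p]-th power only has exponents divisible by [p], so the Cauchy product at [n] keeps the
    single term [i = n %% p], where [apery_lucas] applies. *)
Lemma apery_ps_lucas : apery_ps F = poly_ps aperyp * apery_ps F ^+ p.
Proof.
apply: powserP => n /=.
have nn : (n %% p < n.+1)%N by rewrite ltnS leq_mod.
rewrite (bigD1 (Ordinal nn)) //= big1 ?addr0.
  rewrite ps_exprp coef_poly ltn_mod p_gt0.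
  have -> : (n - n %% p = n %/ p * p)%N by rewrite {1}(divn_eq n p) addnK.
  by rewrite dvdn_mull// mulnK// /= {1}(divn_eq n p) mulnC apery_lucas ?ltn_mod// mulrC.
move=> [i ni] /eqP/= ine; rewrite coef_poly; case: ltnP => ip; last by rewrite mul0r.
rewrite ps_exprp; case: ifP; last by rewrite mulr0.
move=> /dvdnP[k ik]; case: ine; apply: val_inj => /=.
have -> : n = (k * p + i)%N by rewrite -ik subnK// -ltnS.
by rewrite modnMDl modn_small.
Qed.

Lemma apery_ps_neq0 : apery_ps F != 0.
Proof.
apply/eqP => /(congr1 (fun x => pscoef x 0%N)).
by rewrite pscoef0 /= apery0 => /eqP; rewrite oner_eq0.
Qed.

Lemma apery_ps_kummer : poly_ps aperyp * apery_ps F ^+ p.-1 = 1.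
Proof.
apply: (mulfI apery_ps_neq0).
by rewrite mulrCA -exprS prednK// -apery_ps_lucas mulr1.
Qed.

Lemma apery_form_aperyp :
  apery_form 'X aperyp (theta aperyp) (theta (theta aperyp)) = 0.
Proof.
apply: (@poly_ps_inj F); rewrite rmorph0 rmorph_apery_form /= !poly_ps_theta poly_psX.
set a := poly_ps aperyp; set g := apery_ps F ^+ p.
have g1 : pstheta g = 0.
  have D x n : pstheta (x ^+ n) = n%:R * x ^+ n.-1 * pstheta x.
    elim: n => [|n IH]; first by rewrite pstheta1 !mul0r.
    rewrite exprS psthetaM IH; case: n {IH} => [|n] /=; first by ring.
    by rewrite -!natr1 exprS; ring.
  by rewrite D (pcharf0 pchar_powser) !mul0r.
have := apery_form_ps F; cbv zeta; rewrite apery_ps_lucas -/a -/g.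
rewrite psthetaM g1 mulr0 addr0 psthetaM g1 mulr0 addr0.
set a1 := pstheta a; set a2 := pstheta a1.
(* The form is homogeneous of degree 2 in its last three arguments, so the constant [g] factors
   out. *)
have -> : apery_form (psX F) (a * g) (a1 * g) (a2 * g) =
  g ^+ 2 * apery_form (psX F) a a1 a2 by rewrite /apery_form /disc; ring.
move=> /eqP; rewrite mulf_eq0 !expf_eq0 => /orP[|/eqP//].
by rewrite (negPf apery_ps_neq0) !andbF.
Qed.

Lemma size_aperyp : size aperyp = p.
Proof.
rewrite size_poly_eq// apery_predp; exact: oner_neq0.
Qed.

Lemma aperyp0 : aperyp`_0 = 1.
Proof. by rewrite coef_poly p_gt0 apery0. Qed.

End Lucas.

(** * Multiplicities of the factors of the truncation *)

Section Irreducible.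
Variable F : fieldType.
Implicit Types q a b c : {poly F}.

Lemma irreducible_dvdpM q a b : irreducible_poly q ->
  (q %| a * b) = (q %| a) || (q %| b).
Proof.
move=> qi; apply/idP/orP => [|[]]; last 2 first.
- exact: dvdp_mulr.
- exact: dvdp_mull.
have [qa|qa] := boolP (q %| a); first by left.
by rewrite Gauss_dvdpr ?irreducible_poly_coprime// => ->; right.
Qed.

Lemma irreducible_dvdpX q a n : irreducible_poly q -> q %| a ^+ n -> q %| a.
Proof.
move=> qi; elim: n => [|n IH].
  by rewrite expr0 dvdp1 => /eqP q1; move: qi.1; rewrite q1.
by rewrite exprS irreducible_dvdpM// => /orP[].
Qed.

Lemma exists_irreducible_dvdp a : (1 < size a)%N ->
  exists2 q, irreducible_poly q & q %| a.
Proof.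
have [n] := ubnP (size a); elim: n a => // n IH a an a1.
have [ai|ai] := pselect (irreducible_poly a); first by exists a.
have [q [q1 qa nqa]] : exists q, [/\ size q != 1%N, q %| a & ~~ (q %= a)].
  apply: contrapT => h; apply: ai; split=> // q q1 qa.
  by apply: contrapT => /negP nqa; apply: h; exists q.
have a0 : a != 0 by rewrite -size_poly_gt0 (ltn_trans _ a1).
have q0 : q != 0 by apply: contraTneq qa => ->; rewrite dvd0p.
have qlt : (size q < size a)%N.
  rewrite ltn_neqAle dvdp_leq// andbT; apply: contra nqa => sqa.
  by rewrite -dvdp_size_eqp.
have [|r ri rq] := IH q (leq_trans qlt an).
  by rewrite ltn_neqAle eq_sym q1 size_poly_gt0.
by exists r => //; exact: dvdp_trans rq qa.
Qed.

Lemma polyE_dvdp q a : q %| a -> exists c, a = q * c.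
Proof. by move=> /dvdpP[c ->]; exists c; rewrite mulrC. Qed.

Lemma ltn_size_mulp q c : (1 < size q)%N -> c != 0 ->
  (size c < size (q * c)%R)%N.
Proof.
move=> q1 c0; have q0 : q != 0 by rewrite -size_poly_gt0 (ltn_trans _ q1).
have c1 : (0 < size c)%N by rewrite size_poly_gt0.
rewrite size_mul//; move: q1 c1; case: (size q) => [|[|m]] //= _ _.
by rewrite addSn ltnS leq_addl.
Qed.

Lemma dvdp_multiplicity q a : (1 < size q)%N -> a != 0 ->
  exists k c, a = q ^+ k * c /\ ~~ (q %| c).
Proof.
move=> q1; have [n] := ubnP (size a); elim: n a => // n IH a an a0.
have [qa|qa] := boolP (q %| a); last by exists 0%N, a; rewrite mul1r.
have [c ac] := polyE_dvdp qa.
have c0 : c != 0 by apply: contraNneq a0; rewrite ac => ->; rewrite mulr0.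
have [|k [d [cd qd]]] := IH c _ c0.
  by rewrite -ltnS (leq_ltn_trans _ an)// ac ltn_size_mulp.
by exists k.+1, d; rewrite ac cd exprS mulrA.
Qed.

Lemma max_square_dvdp a : a != 0 ->
  exists b c, a = c * b ^+ 2 /\ forall q, irreducible_poly q -> ~~ (q ^+ 2 %| c).
Proof.
have [n] := ubnP (size a); elim: n a => // n IH a an a0.
have [[q qi qa]|h] := pselect (exists2 q, irreducible_poly q & q ^+ 2 %| a); last first.
  exists 1, a; rewrite expr1n mulr1; split=> // q qi; apply/negP => qa.
  by apply: h; exists q.
have [c ac] := polyE_dvdp qa.
have c0 : c != 0 by apply: contraNneq a0; rewrite ac => ->; rewrite mulr0.
have q1 := qi.1.
have [|b [d [cd qd]]] := IH c _ c0.
  rewrite -ltnS (leq_ltn_trans _ an)// ac expr2 -mulrA.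
  have q0 : q != 0 by rewrite -size_poly_gt0 (ltn_trans _ q1).
  by apply: (ltn_trans (ltn_size_mulp q1 c0)); rewrite ltn_size_mulp// mulf_neq0.
by exists (q * b), d; split=> //; rewrite ac cd; ring.
Qed.

End Irreducible.

Lemma size_disc (F : fieldType) : size (disc 'X : {poly F}) = 3%N.
Proof.
rewrite /disc addrC size_polyDl ?size_polyXn// ltnS; apply/leq_sizeP => j j2.
rewrite coefB coef1 mulr_natl coefMn coefX; case: j j2 => [|[]] // j _.
by rewrite mul0rn subrr.
Qed.

(** * Local exponents of the first integral at an irreducible factor *)

Section LocalExponents.
Variable F : fieldType.
Implicit Types q u h : {poly F}.

(** The extra factor [q] avoids the exponent [k - 1], so [k = 0] is no exception. *)
Lemma theta_exp q k : q * theta (q ^+ k) = k%:R * theta q * q ^+ k.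
Proof.
elim: k => [|k IH]; first by rewrite thetaC !mul0r mulr0.
rewrite exprS thetaM -natr1.
transitivity (q * (theta q * q ^+ k) + q * (q * theta (q ^+ k))); first by ring.
by rewrite IH; ring.
Qed.

Lemma theta2_exp q k :
  q ^+ 2 * theta (theta (q ^+ k)) =
  (k%:R * q * theta (theta q) + k%:R * (k%:R - 1) * theta q ^+ 2) * q ^+ k.
Proof.
have e := congr1 (fun x => q * @theta F x) (theta_exp q k); move: e.
rewrite /= !thetaM theta_nat mul0r add0r; set q1 := theta q; set u := q ^+ k.
set u1 := theta u => e.
have e1 : q * u1 = k%:R * q1 * u by rewrite theta_exp.
transitivity (q * (q1 * u1 + q * theta u1) - q1 * (q * u1)); first by ring.
rewrite e.
transitivity (k%:R * theta q1 * u * q + (k%:R - 1) * q1 * (q * u1)); first by ring.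
by rewrite e1; ring.
Qed.

Section Exponents.
Variables (p : nat) (pF : p \in [pchar F]) (p_gt3 : (3 < p)%N).

Let nz m : (0 < m < p)%N -> m%:R != 0 :> F.
Proof.
move=> mp; rewrite -(dvdn_pcharf pF); apply/negP => /dvdn_leq; lia.
Qed.

Let p_prime : prime p := pcharf_prime pF.

(** [1152 = 34 ^ 2 - 4] is the discriminant of [1 - 34 t + t^2]; its only prime factors are 2 and
    3. *)
Lemma natr_1152_neq0 : 1152%:R != 0 :> F.
Proof.
rewrite -(dvdn_pcharf pF) (_ : 1152%N = 2 ^ 7 * 3 ^ 2)%N//.
rewrite Euclid_dvdM// !Euclid_dvdX//= !dvdn_prime2//.
by apply/negP => /orP[] /eqP; lia.
Qed.

(** A double factor of [D] divides [D] and its derivative [D'], hence the constant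
    [D'^2 - 4 D = 1152]. *)
Lemma disc_squarefree q : irreducible_poly q -> ~~ (q ^+ 2 %| disc 'X).
Proof.
move=> qi; apply/negP => /polyE_dvdp[c Dc].
have D' : q %| (2%:R * 'X - 34%:R : {poly F}).
  have -> : (2%:R * 'X - 34%:R : {poly F}) = (disc 'X)^`().
    have dn m : (m%:R : {poly F})^`() = 0 by rewrite -polyC_natr derivC.
    by rewrite /disc derivD derivB (dn 1%N) derivXn derivM dn derivX /=; ring.
  rewrite Dc derivM expr2 derivM.
  have -> : (q^`() * q + q * q^`()) * c + q * q * c^`()
    = q * (2%:R * q^`() * c + q * c^`()) by ring.
  exact: dvdp_mulr.
have : q %| (2%:R * 'X - 34%:R) ^+ 2 - 4%:R * (disc 'X : {poly F}).
  apply: dvdp_sub; first by rewrite expr2 dvdp_mulr.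
  by rewrite Dc expr2 -mulrA dvdp_mull// dvdp_mulr.
have -> : (2%:R * 'X - 34%:R) ^+ 2 - 4%:R * (disc 'X : {poly F}) = 1152%:R%:P.
  by rewrite /disc polyC_natr; ring.
by move/dvdp_leq; rewrite polyC_eq0 natr_1152_neq0 size_polyC natr_1152_neq0 => /(_ isT);
  rewrite leqNgt qi.1.
Qed.

Variables (a q h : {poly F}) (k : nat).
Hypotheses (a_form : apery_form 'X a (theta a) (theta (theta a)) = 0)
  (a_0 : a`_0 != 0) (qi : irreducible_poly q) (ah : a = q ^+ k * h)
  (qh : ~~ (q %| h)) (kp : (0 < k < p)%N) (qp : (size q <= p)%N).

Let q_n0 : q != 0.
Proof. by rewrite -size_poly_gt0 (ltn_trans _ qi.1). Qed.

(** Here [theta q = X q']. If [q] divided [X], then [a] would vanish at 0; and [q'] is nonzero of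
    smaller degree because the degree of [q] is below [p]. *)
Lemma irreducible_ndvd_theta : ~~ (q %| theta q).
Proof.
rewrite thetaE irreducible_dvdpM// negb_or; apply/andP; split; apply/negP.
  move=> /polyE_dvdp[c Xc].
  have : (q * c)`_0 = 0 by rewrite -Xc coefX.
  rewrite coef0M => /eqP; rewrite mulf_eq0 => /orP[] c0.
    move: a_0; rewrite ah coef0M.
    have -> : (q ^+ k)`_0 = q`_0 ^+ k by rewrite -!horner_coef0 horner_exp.
    by rewrite (eqP c0) expr0n; case: k kp => //= k' _; rewrite mul0r eqxx.
  have : (q * c)`_1 = 1 by rewrite -Xc coefX.
  have cX : c = 'X * (c %/ 'X).
    rewrite mulrC divpK//; have := dvdp_XsubCl c 0.
    by rewrite subr0 => ->; rewrite rootE horner_coef0.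
  have := congr1 (fun x : {poly F} => size x) Xc.
  have c_n0 : c != 0 by apply: contra_eq_neq Xc => ->; rewrite mulr0 polyX_eq0.
  rewrite size_polyX size_mul// => e _.
  have : (1 < size c)%N.
    rewrite ltnNge; apply/negP => /size1_polyC cC.
    by move: c_n0; rewrite cC (eqP c0) eqxx.
  move: e qi.1; case: (size q) => [|[|m]] //; case: (size c) => [|[|n]] //=.
  lia.
have sq := qi.1.
have d_n0 : q^`() != 0.
  apply/eqP => /(congr1 (fun x : {poly F} => x`_(size q).-2)).
  rewrite coef_deriv coef0 -mulr_natr => /eqP; rewrite mulf_eq0.
  have -> : (size q).-2.+1 = (size q).-1 by move: sq; case: (size q) => [|[]].
  rewrite -lead_coefE lead_coef_eq0 (negPf q_n0) /=; apply/negP/nz.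
  by move: sq qp; case: (size q) => [|[|m]].
by move=> /(dvdp_leq d_n0); rewrite leqNgt lt_size_deriv.
Qed.

Let q1 := theta q.
(** [w1] and [w2] are [q * theta a] and [q ^+ 2 * theta (theta a)] with the factor [q ^+ k]
    removed. *)
Let w1 := k%:R * q1 * h + q * theta h.
Let w2 := (k%:R * q * theta q1 + k%:R * (k%:R - 1) * q1 ^+ 2) * h
  + 2%:R * k%:R * q * q1 * theta h + q ^+ 2 * theta (theta h).

(** The equation of [a], multiplied by [q ^+ 2] and divided by [q ^+ (2 * k)]. *)
Let form_local : disc 'X * (2%:R * h * w2 - w1 ^+ 2)
  + (2%:R * 'X ^+ 2 - 34%:R * 'X) * h * q * w1
  + ('X ^+ 2 - 10%:R * 'X) * q ^+ 2 * h ^+ 2 = 0.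
Proof.
have e1 : q * theta a = q ^+ k * w1.
  rewrite ah thetaM mulrDr mulrA theta_exp /w1 -/q1; ring.
have e2 : q ^+ 2 * theta (theta a) = q ^+ k * w2.
  rewrite ah thetaM thetaD !thetaM.
  transitivity (q ^+ 2 * theta (theta (q ^+ k)) * h
    + 2%:R * q * (q * theta (q ^+ k)) * theta h
    + q ^+ k * q ^+ 2 * theta (theta h)); first by ring.
  by rewrite theta2_exp theta_exp /w2 -/q1; ring.
apply: (mulfI (_ : (q ^+ k) ^+ 2 != 0)); first by rewrite !expf_neq0.
rewrite mulr0 -[RHS](mulr0 (q ^+ 2)) -a_form /apery_form.
transitivity (disc 'X * (2%:R * a * (q ^+ 2 * theta (theta a)) - (q * theta a) ^+ 2)
  + (2%:R * 'X ^+ 2 - 34%:R * 'X) * a * q * (q * theta a)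
  + ('X ^+ 2 - 10%:R * 'X) * q ^+ 2 * a ^+ 2); last by ring.
by rewrite e1 e2 ah; ring.
Qed.

(** Modulo [q] the factors [s], [theta q] and [h] are invertible, so the scalar has to vanish. *)
Let q_dvd_nat (m n : F) (s r : {poly F}) : ~~ (q %| s) ->
  s * (m * n)%:P * (theta q ^+ 2 * h ^+ 2) + q * r = 0 -> (m == 0) || (n == 0).
Proof.
move=> qs e; rewrite -mulf_eq0.
have : q %| s * (m * n)%:P * (theta q ^+ 2 * h ^+ 2).
  by rewrite -(addrK (q * r) (_ * _)) e sub0r dvdpNr dvdp_mulr.
rewrite !irreducible_dvdpM// (negPf qs) (negPf irreducible_ndvd_theta) (negPf qh).
rewrite /= orbF.
apply: contraLR => mn; apply/negP => /dvdp_leq.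
by rewrite polyC_eq0 mn size_polyC mn => /(_ isT); rewrite leqNgt qi.1.
Qed.

(** Modulo [q], [form_local] reduces to [D h^2 (theta q)^2] times
    [2 k (k - 1) - k^2 = k (k - 2)]. *)
Lemma multiplicity_ordinary : ~~ (q %| disc 'X) -> k = 2%N.
Proof.
move=> qD; apply/eqP; rewrite -[_ == _]negbK; apply/negP => k2.
have /orP[] : (k%:R == 0 :> F) || (k%:R - 2%:R == 0 :> F).
- apply: (q_dvd_nat (s := disc 'X) (r := disc 'X * (2%:R * h * (k%:R * theta q1 * h
    + 2%:R * k%:R * q1 * theta h + q * theta (theta h)) - 2%:R * k%:R * q1 * h * theta h
    - q * theta h ^+ 2) + (2%:R * 'X ^+ 2 - 34%:R * 'X) * h * w1
    + ('X ^+ 2 - 10%:R * 'X) * q * h ^+ 2)) => //.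
  rewrite -[RHS]form_local /w1 /w2 polyCM polyCB !polyC_natr /q1; ring.
- by apply/negP/nz.
have [k1|k3] : (k = 1 \/ 2 < k)%N by lia.
  by rewrite k1 -opprB oppr_eq0 -natrB// oner_eq0.
by rewrite -natrB 1?ltnW//; apply/negP/nz; lia.
Qed.

(** With [D = q c], the first order coefficient is [theta D = c theta q + q theta c]. Dividing
    [form_local] by [q] and reducing modulo [q] gives the indicial polynomial
    [k (k - 2) + k = k (k - 1)]. *)
Lemma multiplicity_singular : q %| disc 'X -> k = 1%N.
Proof.
move=> /polyE_dvdp[c Dc]; apply/eqP; rewrite -[_ == _]negbK; apply/negP => k1.
have qc : ~~ (q %| c).
  apply/negP => qc; have := disc_squarefree qi.
  by rewrite Dc expr2 dvdp_mul.
have tD : theta (disc 'X) = 2%:R * 'X ^+ 2 - 34%:R * 'X :> {poly F}.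
  rewrite /disc expr2 thetaD thetaD thetaN !thetaM thetaX theta_nat.
  by rewrite (theta_nat _ 1%N); ring.
have := form_local; rewrite -tD Dc thetaM -/q1 => e.
have /orP[] : (k%:R == 0 :> F) || (k%:R - 1 == 0 :> F).
- apply: (q_dvd_nat (s := c) (r := c * (2%:R * h * (k%:R * theta q1 * h
    + 2%:R * k%:R * q1 * theta h + q * theta (theta h)) - 2%:R * k%:R * q1 * h * theta h
    - q * theta h ^+ 2) + theta c * h * w1 + c * q1 * h * theta h
    + ('X ^+ 2 - 10%:R * 'X) * h ^+ 2)) => //.
  apply: (mulfI q_n0); rewrite mulr0 -[RHS]e /w1 /w2 polyCM polyCB !polyC_natr.
  rewrite -/q1; ring.
- by apply/negP/nz.
by rewrite -(natrB _ (_ : 1 <= k)%N); [apply/negP/nz; lia | lia].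
Qed.

End Exponents.
End LocalExponents.

(** * The truncation is a square or [D] times a square *)

Section Shape.
Variables (p : nat) (p_prime : prime p) (p_gt3 : (3 < p)%N).
Local Notation F := 'F_p.
Local Notation A := (aperyp p).

Let A_neq0 : A != 0.
Proof. by rewrite -size_poly_gt0 size_aperyp// prime_gt0. Qed.

(** Since [A] has degree [p - 1], both [k] and the degree of [q] lie below [p], as the local
    analysis requires. *)
Lemma aperyp_multiplicity (q h : {poly F}) k : irreducible_poly q -> (0 < k)%N ->
  A = q ^+ k * h -> ~~ (q %| h) -> k = if q %| disc 'X then 1%N else 2%N.
Proof.
move=> qi k0 Ah qh.
have q0 : q != 0 by rewrite -size_poly_gt0 (ltn_trans _ qi.1).
have h0 : h != 0 by apply: contraNneq A_neq0 => h0; rewrite Ah h0 mulr0.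
have sA : (size A = (size q).-1 * k + size h)%N.
  have qk : size (q ^+ k) = ((size q).-1 * k).+1.
    by rewrite -size_exp prednK// size_poly_gt0 expf_neq0.
  by rewrite Ah size_mul ?expf_neq0// qk.
rewrite size_aperyp// in sA.
have h1 : (0 < size h)%N by rewrite size_poly_gt0.
have q1 := qi.1.
have [kp qp] : (k < p)%N /\ (size q <= p)%N.
  by move: sA q1 h1; move: (size q) (size h) => [|[|s]] t //= -> _ t0; split; nia.
have {}kp : (0 < k < p)%N by rewrite k0.
have pF := pchar_Fp p_prime.
have A0 : A`_0 != 0 by rewrite aperyp0// oner_eq0.
have Af := apery_form_aperyp p_prime.
case: ifP => [qD|/negbT qD].
  exact: (multiplicity_singular pF p_gt3 Af A0 qi Ah qh kp qp).
exact: (multiplicity_ordinary pF p_gt3 Af A0 qi Ah qh kp qp).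
Qed.

(** An irreducible factor of multiplicity [k > 0] in [g] has multiplicity [k * e] in [A], which is 1
    or 2. *)
Lemma aperyp_eq_exp (g : {poly F}) e : A = g ^+ e -> (e <= 2)%N.
Proof.
move=> Ag; have p1 := prime_gt1 p_prime.
have g1 : (1 < size g)%N.
  rewrite ltnNge; apply/negP => /size1_polyC gC.
  have := size_aperyp p_prime; rewrite Ag gC -polyC_exp size_polyC; case: eqP => /=; lia.
have [q qi /polyE_dvdp[c gc]] := exists_irreducible_dvdp g1.
have g0 : g != 0 by rewrite -size_poly_gt0 (ltn_trans _ g1).
have [k [h [gh qh]]] := dvdp_multiplicity qi.1 g0.
have k0 : (0 < k)%N.
  by case: k gh => // gh; move: qh; rewrite -[h]mul1r -(expr0 q) -gh gc dvdp_mulr.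
have [->//|e0] := posnP e.
have h1 : ~~ (q %| h ^+ e) by apply: contra qh; exact: irreducible_dvdpX.
have := @aperyp_multiplicity q (h ^+ e) (k * e) qi _ _ h1.
rewrite muln_gt0 k0 e0 exprM -exprMn -gh => /(_ isT Ag).
by case: ifP => _ ?; nia.
Qed.

Lemma aperyp_shape : exists B : {poly F},
  B`_0 = 1 /\ (A = B ^+ 2 \/ A = disc 'X * B ^+ 2).
Proof.
have [B [G [AG Gsf]]] := max_square_dvdp A_neq0.
have G0 : G != 0 by apply: contraNneq A_neq0 => h0; rewrite AG h0 mul0r.
have B0 : B != 0 by apply: contraNneq A_neq0 => h0; rewrite AG h0 expr0n mulr0.
have sD := size_disc F.
(* An irreducible factor of the squarefree [G] has odd multiplicity in [A], hence divides [D]. So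
   the cofactor of [gcdp G D] in [G] is constant. *)
have GD : G %| disc 'X.
  set d := gcdp G (disc 'X).
  have [c Gc] : exists c, G = d * c by apply: polyE_dvdp; exact: dvdp_gcdl.
  have d_n0 : d != 0 by apply: contraNneq G0 => h0; rewrite Gc h0 mul0r.
  have c_n0 : c != 0 by apply: contraNneq G0 => h0; rewrite Gc h0 mulr0.
  have [c1|c1] := leqP (size c) 1; last first.
    have [q qi /polyE_dvdp[c' cc]] := exists_irreducible_dvdp c1.
    have Gq : G = q * (d * c') by rewrite Gc cc; ring.
    have qdc : ~~ (q %| d * c').
      by have := Gsf q qi; apply: contra => qdc; rewrite Gq expr2 dvdp_mul.
    have [j [h [Bh qh]]] := dvdp_multiplicity qi.1 B0.
    have Ae : A = q ^+ j.*2.+1 * (d * c' * h ^+ 2).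
      by rewrite AG Gq Bh (exprS q) -addnn exprD; ring.
    have qn : ~~ (q %| d * c' * h ^+ 2).
      rewrite irreducible_dvdpM// negb_or qdc /=; apply: contra qh.
      exact: irreducible_dvdpX.
    have := aperyp_multiplicity qi (ltn0Sn _) Ae qn.
    case: ifP => [qD _|_]; last by lia.
    have : q %| d by rewrite dvdp_gcd qD andbT Gq dvdp_mulr.
    by move=> qd; move: qdc; rewrite dvdp_mulr.
  have : G %= d.
    rewrite Gc -{2}[d]mulr1 eqp_mul2l// -size_poly_eq1.
    by move: c1 c_n0; rewrite -size_poly_gt0; case: size => [|[]].
  by move/eqp_dvdl->; exact: dvdp_gcdr.
have D0 : disc 'X != 0 :> {poly F} by rewrite -size_poly_gt0 sD.
(* Degree 1 is excluded by parity: [A] has even degree [p - 1]. *)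
have sG : size G = 1%N \/ size G = 3%N.
  have := dvdp_leq D0 GD; rewrite sD.
  have := size_aperyp p_prime; rewrite AG size_mul ?expf_neq0// expr2 size_mul//.
  have oddp : odd p by case: (even_prime p_prime) => // p2; move: p_gt3; rewrite p2.
  have := odd_double_half p; rewrite oddp.
  have : (0 < size B)%N by rewrite size_poly_gt0.
  have : (0 < size G)%N by rewrite size_poly_gt0.
  by move: (size B) (size G) (p./2) => b g m; lia.
have A0 := aperyp0 p_prime; rewrite AG in A0.
have b2 : (B ^+ 2)`_0 = B`_0 ^+ 2 by rewrite expr2 coef0M.
rewrite coef0M b2 in A0.
have b0 : B`_0 != 0.
  by apply: contra_eq_neq A0 => ->; rewrite expr0n mulr0 eq_sym oner_eq0.
(* Since [A] has constant term 1, the square of this normalization is [B ^+ 2] times the constant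
   term of [G]. *)
exists ((B`_0)^-1 *: B); rewrite coefZ mulVf//; split=> //.
have sq : ((B`_0)^-1 *: B) ^+ 2 = (G`_0)%:P * B ^+ 2.
  rewrite exprZn -mul_polyC; congr (_%:P * _).
  by rewrite exprVn; apply: (mulIf (_ : B`_0 ^+ 2 != 0)); rewrite ?expf_neq0// mulVf ?expf_neq0// A0.
case: sG => sG.
  left; rewrite sq AG; congr (_ * _).
  by move/eqP: sG; rewrite eqn_leq => /andP[/size1_polyC ->]; rewrite coefC.
right; rewrite sq AG; suff Ge : G = disc 'X * (G`_0)%:P by rewrite {1}Ge -mulrA.
have /eqpP[[c1 c2] /= /andP[c10 c20] e] : G %= disc 'X.
  by rewrite -dvdp_size_eqp// sG sD.
have D00 : (disc 'X : {poly F})`_0 = 1.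
  by rewrite /disc !coefD coef1 coefN coef0M coefX mulr0 coefXn oppr0 !addr0.
have := congr1 (fun x : {poly F} => x`_0) e; rewrite /= !coefZ D00 mulr1 => e0.
by apply: (scalerI c10); rewrite e -e0 -!mul_polyC polyCM; ring.
Qed.

End Shape.

(** * Homogenization and the quadratic character of 2 *)

(** Both sides are the coefficient of [X^m] in [(1 + X)^m (1 - (1 + X))^m = (1 + X)^m (- X)^m]. *)
Lemma sum_bin_alternating (R : comNzRingType) m :
  \sum_(j < m.+1) (-1) ^+ j * ('C(m, j) * 'C(m + j, j))%:R = (-1) ^+ m :> R.
Proof.
transitivity ((((1 + 'X) ^+ m * (1 - (1 + 'X)) ^+ m) : {poly R})`_m).
  rewrite exprBn mulr_sumr coef_sum; apply: eq_bigr => j _.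
  rewrite expr1n mulr1.
  transitivity (((((-1) ^+ j * 'C(m, j)%:R)%:P * (1 + 'X) ^+ (m + j)) : {poly R})`_m).
    have -> : 'C(m + j, j) = 'C(m + j, m) by rewrite -bin_sub ?leq_addl// addnK.
    by rewrite coefCM coef_exp1X natrM; ring.
  apply: (congr1 (fun q : {poly R} => q`_m)); rewrite polyCM polyC_exp polyCN polyC_natr exprD; ring.
have -> : 1 - (1 + 'X) = - 'X :> {poly R} by ring.
rewrite (exprNn 'X) mulrA coefMXn ltnn subnn.
have -> : (-1) ^+ m = ((-1) ^+ m)%:P :> {poly R} by rewrite polyC_exp polyCN.
by rewrite coefMC coef_exp1X bin0 mul1r.
Qed.

Section SecondSupplement.
Variables (p : nat) (p_prime : prime p) (p_gt2 : (2 < p)%N).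
Local Notation F := 'F_p.
Local Notation d := ('X^2 + 1 : {poly F}).

Let dvd_lin (c e : F) : e != 0 -> d %| c%:P * (1 + e%:P * 'X) -> c = 0.
Proof.
move=> e0 h; apply/eqP; apply/negP => /negP c0.
have sz : size (c%:P * (1 + e%:P * 'X)) = 2%N.
  rewrite size_Cmul// addrC size_polyDl ?size_Cmul ?size_polyX// size_poly1//.
have n0 : c%:P * (1 + e%:P * 'X) != 0 by rewrite -size_poly_gt0 sz.
have := dvdp_leq n0 h; rewrite sz size_polyDl size_polyXn// size_poly1//.
Qed.

(** [(1 + i) ^+ 2 = 2 * i] for a square root [i] of [-1], here the class of
['X] modulo ['X^2 + 1]. *)
Lemma natr2_exp_half : (2%:R : F) ^+ p./2 = if (p %% 8)%N \in [:: 1; 7]%N then 1 else -1.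
Proof.
set c := _ ^+ _.
have pE : p = (p./2.*2).+1.
  by rewrite -{1}(odd_double_half p); case: (even_prime p_prime) p_gt2 => [->|->].
have dX n k : d %| 'X^(4 * k + n) - 'X^n.
  have -> : 'X^(4 * k + n) - 'X^n = ('X^4 ^+ k - 1 ^+ k) * 'X^n :> {poly F}.
    by rewrite exprD exprM expr1n mulrBl mul1r.
  rewrite subrXX -mulrA dvdp_mulr//.
  have -> : 'X^4 - 1 = d * ('X^2 - 1) :> {poly F} by ring.
  exact: dvdp_mulr.
(* Two evaluations of [(1 + X)^p]: by Frobenius, and through [(1 + X)^2 = 2 X] modulo [d]. *)
have key : d %| c%:P * (1 + 'X) * 'X^(p./2) - (1 + 'X^p).
  have -> : 1 + 'X^p = (1 + 'X) * ((1 + 'X) ^+ 2) ^+ p./2 :> {poly F}.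
    by rewrite -exprpD1// -exprM mul2n -exprS -pE.
  have -> : (1 + 'X) ^+ 2 = d + 2%:R * 'X :> {poly F} by ring.
  have -> : c%:P * (1 + 'X) * 'X^(p./2) - (1 + 'X) * (d + 2%:R * 'X) ^+ p./2
    = - ((d + 2%:R * 'X) ^+ p./2 - (2%:R * 'X) ^+ p./2) * (1 + 'X).
    rewrite (exprMn _ 2%:R 'X) /c polyC_exp polyC_natr; ring.
  rewrite subrXX addrK -mulNr -!mulrA mulNr dvdpNr.
  exact: dvdp_mulr.
(* As [X^4 = 1] modulo [d], only the class of [p] modulo 8 matters. In each of the four cases an
   explicit multiple of [d] reduces [key2] to a linear polynomial. *)
have [k [r [pkr r8]]] : exists k r, p = (8 * k + r.*2.+1)%N /\ (r < 4)%N.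
  exists (p %/ 8)%N, (p %% 8)./2; move: pE; lia.
have halfE : p./2 = (4 * k + r)%N by lia.
have h1 : d %| 'X^(p./2) - 'X^r by rewrite halfE.
have h2 : d %| 'X^p - 'X^(r.*2.+1).
  have dp N : N = (8 * k + r.*2.+1)%N -> d %| 'X^N - 'X^(r.*2.+1).
    by move->; rewrite (_ : (8 * k = 4 * (2 * k))%N) ?dX//; lia.
  exact: dp.
have key2 : d %| c%:P * (1 + 'X) * 'X^r - (1 + 'X^(r.*2.+1)).
  have -> : c%:P * (1 + 'X) * 'X^r - (1 + 'X^(r.*2.+1)) =
    c%:P * (1 + 'X) * 'X^(p./2) - (1 + 'X^p)
    - c%:P * (1 + 'X) * ('X^(p./2) - 'X^r) + ('X^p - 'X^(r.*2.+1)) by ring.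
  exact: dvdp_add (dvdp_sub key (dvdp_mull _ h1)) h2.
have -> : (p %% 8 = r.*2.+1)%N by lia.
have m1 : -1 != 0 :> F by rewrite oppr_eq0 oner_eq0.
case: r r8 key2 {pkr halfE h1 h2} => [|[|[|[|//]]]] _ /= key2;
  apply/eqP; rewrite -subr_eq0; apply/eqP.
- apply: (dvd_lin (oner_neq0 _)); apply: etrans key2; congr (_ %| _).
  by rewrite polyCB; ring.
- rewrite opprK; apply: (dvd_lin m1); rewrite -dvdpNr.
  rewrite (_ : - _ = c%:P * (1 + 'X) * 'X^1 - (1 + 'X^3) + d * ('X - c%:P)).
    by rewrite dvdp_add// dvdp_mulr.
  by rewrite polyCD polyCN; ring.
- rewrite opprK; apply: (dvd_lin (oner_neq0 _)); rewrite -dvdpNr.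
  rewrite (_ : - _ = c%:P * (1 + 'X) * 'X^2 - (1 + 'X^5)
    + d * ('X^3 - 'X - c%:P * (1 + 'X))).
    by rewrite dvdp_add// dvdp_mulr.
  by rewrite polyCD; ring.
apply: (dvd_lin m1).
rewrite (_ : _ * _ = c%:P * (1 + 'X) * 'X^3 - (1 + 'X^7)
    + d * (c%:P * (1 - 'X - 'X^2) + 'X^5 - 'X^3 + 'X)).
  by rewrite dvdp_add// dvdp_mulr.
by rewrite polyCB polyCN; ring.
Qed.

End SecondSupplement.

Section Homogenization.
Variable F : fieldType.
Implicit Types a b x y : {poly F}.

Lemma size_mulp_leq a b N M : (size a <= N.+1)%N -> (size b <= M.+1)%N ->
  (size (a * b)%R <= (N + M).+1)%N.
Proof.
move=> aN bM; apply: leq_trans (size_polyMleq a b) _.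
by rewrite -subn1 leq_subLR (leq_trans (leq_add aN bM))// addSn addnS.
Qed.

(** The polynomial form of [y^N a(x / y)], that is, substitution with denominators cleared;
    coefficients of [a] beyond [N] are dropped. *)
Definition homog x y N a : {poly F} :=
  \sum_(i < N.+1) a`_i *: (x ^+ i * y ^+ (N - i)).

Lemma homogD x y N : {morph homog x y N : a b / a + b}.
Proof.
move=> a b; rewrite /homog -big_split; apply: eq_bigr => i _.
by rewrite coefD scalerDl.
Qed.

Lemma homogZ x y N c a : homog x y N (c%:P * a) = c%:P * homog x y N a.
Proof.
rewrite /homog mulr_sumr; apply: eq_bigr => i _.
by rewrite coefCM mul_polyC scalerA.
Qed.

(** In the fraction field [homog] is [y^N] times evaluation at [x / y], which is multiplicative. *)
Lemma homogM x y N M a b : y != 0 -> (size a <= N.+1)%N -> (size b <= M.+1)%N ->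
  homog x y (N + M) (a * b) = homog x y N a * homog x y M b.
Proof.
move=> y0; pose phi : {rmorphism {poly F} -> {fraction {poly F}}} := @FracField.tofrac _.
have phiy : phi y != 0 by rewrite tofrac_eq0.
have phi_inj : injective phi by move=> u v /eqP; rewrite tofrac_eq => /eqP.
pose ev a := (map_poly (phi \o polyC) a).[phi x / phi y].
have hE K (e : {poly F}) : (size e <= K.+1)%N -> phi (homog x y K e) = phi y ^+ K * ev e.
  move=> eK; rewrite /ev (@horner_coef_wide _ K.+1); last first.
    exact: leq_trans (size_poly _ _) eK.
  rewrite mulr_sumr rmorph_sum; apply: eq_bigr => -[i iK] _ /=.
  rewrite -mul_polyC !rmorphM !rmorphXn coef_map /= expr_div_n.
  rewrite -{2}(subnK (iK : (i <= K)%N)) exprD.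
  have : phi y ^+ i != 0 by rewrite expf_neq0.
  move: (phi y ^+ i) => u u0.
  by rewrite [RHS]mulrACA [u * _]mulrCA mulfV// mulr1 [in LHS]mulrA [LHS]mulrC mulrA.
move=> aN bM; apply: phi_inj; rewrite rmorphM !hE//.
  by rewrite /ev rmorphM hornerM exprD; ring.
exact: size_mulp_leq.
Qed.

Lemma homog1 x y : homog x y 1 1 = y.
Proof.
by rewrite /homog big_ord_recl big_ord1 !coef1 /= scale1r scale0r addr0 mul1r.
Qed.

Lemma homogX x y : homog x y 1 'X = x.
Proof.
by rewrite /homog big_ord_recl big_ord1 !coefX /= scale1r scale0r add0r mulr1.
Qed.

(** The chain rule for [y^N a(x / y)], multiplied by [x y] to clear denominators and checked term by
    term. *)
Lemma theta_homog x y N a : x * y * theta (homog x y N a) =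
  (y * theta x - x * theta y) * homog x y N (theta a)
  + N%:R * x * theta y * homog x y N a.
Proof.
have theta_sum (I : Type) (r : seq I) (G : I -> {poly F}) :
    theta (\sum_(i <- r) G i) = \sum_(i <- r) theta (G i).
  elim: r => [|i r IH]; first by rewrite !big_nil (theta_nat _ 0).
  by rewrite !big_cons thetaD IH.
rewrite /homog theta_sum !mulr_sumr -big_split; apply: eq_bigr => -[i iN] _ /=.
rewrite coef_theta -!mul_polyC polyCM polyC_natr !thetaM thetaC mul0r add0r.
have -> : N%:R = i%:R + (N - i)%:R :> {poly F} by rewrite -natrD subnKC.
set z := (N - i)%N.
transitivity ((a`_i)%:P * (y * y ^+ z * (x * theta (x ^+ i))
  + x * x ^+ i * (y * theta (y ^+ z)))).
  by ring.
by rewrite !theta_exp; ring.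
Qed.

(** [a] has degree at most, not necessarily equal to, [N]. *)
Definition deg_top N a (c : F) := (size a <= N.+1)%N /\ a`_N = c.

Lemma deg_topM N M a b c e :
  deg_top N a c -> deg_top M b e -> deg_top (N + M) (a * b) (c * e).
Proof.
move=> [aN ac] [bM be]; split.
exact: size_mulp_leq.
have iN : (N < (N + M).+1)%N by lia.
rewrite coefM (bigD1 (Ordinal iN)) //= addKn ac be big1 ?addr0// => -[i iNM] /= h.
have {h} : i != N by apply: contra h => /eqP iE; apply/eqP/val_inj.
case: ltngtP => // [iltN|Nlti] _; last first.
  by rewrite [a`_ _]nth_default ?mul0r// (leq_trans aN).
by rewrite [b`_ _]nth_default ?mulr0// (leq_trans bM)//; lia.
Qed.

Lemma deg_topX N a c k : deg_top N a c -> deg_top (N * k) (a ^+ k) (c ^+ k).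
Proof.
move=> ac; elim: k => [|k IH]; first by rewrite muln0 !expr0; split; rewrite ?size_poly1 ?coef1.
by rewrite mulnS !exprS; apply: deg_topM.
Qed.

Lemma deg_top_homog n x y c e N a : deg_top n x c -> deg_top n y e ->
  deg_top (n * N) (homog x y N a) (\sum_(i < N.+1) a`_i * (c ^+ i * e ^+ (N - i))).
Proof.
move=> xc ye.
have h (i : 'I_N.+1) : deg_top (n * N) (x ^+ i * y ^+ (N - i)) (c ^+ i * e ^+ (N - i)).
  have -> : (n * N = n * i + n * (N - i))%N by rewrite -mulnDr subnKC// -ltnS.
  by apply: deg_topM; apply: deg_topX.
split; last by rewrite coef_sum; apply: eq_bigr => i _; rewrite coefZ (h i).2.
apply: (leq_trans (size_sum _ _ _)); apply/bigmax_leqP => i _.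
exact: leq_trans (size_scale_leq _ _) (h i).1.
Qed.

Lemma coef0_homog x y N a : x`_0 = 0 -> y`_0 = 1 -> (homog x y N a)`_0 = a`_0.
Proof.
move=> x0 y0; rewrite /homog big_ord_recl coefD coefZ mul1r subn0.
have cX (q : {poly F}) k : (q ^+ k)`_0 = q`_0 ^+ k.
  by rewrite -!horner_coef0 horner_exp.
rewrite cX y0 expr1n mulr1 coef_sum big1 ?addr0// => i _.
by rewrite coefZ coef0M cX x0 exprS !mul0r mulr0.
Qed.

End Homogenization.

(** * Pullback to level 6 *)

Section LevelSix.
Variable F : fieldType.
Implicit Types w G : {poly F}.

(** Under the substitution [t = - z / quad6], [disc t] becomes the square of
[(1 - 72 z ^ 2) / quad6], and [op6] is the pullback of the second order operator
whose symmetric square is the Apery operator. *)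
Definition quad6 : {poly F} := 1 - 17%:R * 'X + 72%:R * 'X ^+ 2.

Definition op6 w : {poly F} :=
  quad6 * theta (theta w) + theta quad6 * theta w + (72%:R * 'X ^+ 2 - 6%:R * 'X) * w.

Definition form6 w : {poly F} :=
  quad6 * (2%:R * w * theta (theta w) - theta w ^+ 2)
  + 2%:R * theta quad6 * w * theta w + 4%:R * (72%:R * 'X ^+ 2 - 6%:R * 'X) * w ^+ 2.

Lemma theta_quad6 : theta quad6 = 144%:R * 'X ^+ 2 - 17%:R * 'X.
Proof.
by rewrite /quad6 expr2 !thetaD thetaN !thetaM thetaX !theta_nat (theta_nat _ 1%N); ring.
Qed.

(** The symmetric square relation: it turns the quadratic equation of a square into a linear one for
    the root. *)
Lemma form6_sqr G : form6 (G ^+ 2) = 4%:R * G ^+ 3 * op6 G.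
Proof. by rewrite /form6 /op6 expr2 !(thetaM, thetaD); ring. Qed.

Lemma op6B w G : op6 (w - G) = op6 w - op6 G.
Proof. by rewrite /op6 !(thetaD, thetaN); ring. Qed.

(** The equation expresses [n^2] times the [n]-th coefficient through earlier ones, and [n] is
    invertible for [0 < n < p]. *)
Lemma op6_unique p w : p \in [pchar F] -> (size w <= p)%N ->
  op6 w = 0 -> w`_0 = 0 -> w = 0.
Proof.
move=> pF wp w6 w0; apply/polyP => n; rewrite coef0.
have [pn|np] := leqP p n; first by rewrite nth_default// (leq_trans wp).
elim/ltn_ind: n np => -[|n] IH np; first by [].
have z k : (k <= n)%N -> w`_k = 0 by move=> kn; apply: IH; lia.
have /(congr1 (fun q : {poly F} => q`_n.+1)) : theta (theta w)
   + 'X * (- 17%:R%:P * theta (theta w) - 17%:R%:P * theta w - 6%:R%:P * w)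
   + 'X * ('X * (72%:R%:P * theta (theta w) + 144%:R%:P * theta w + 72%:R%:P * w)) = 0.
  rewrite -w6 /op6 theta_quad6 /quad6 !polyC_natr; ring.
rewrite coef0 !coefD !coefXM /=.
have -> : (- 17%:R%:P * theta (theta w) - 17%:R%:P * theta w - 6%:R%:P * w)`_n = 0.
  by rewrite -polyCN !coefB !coefCM !coef_theta z// !mulr0 !subr0.
have -> : (if n == 0 then 0 else
   (72%:R%:P * theta (theta w) + 144%:R%:P * theta w + 72%:R%:P * w)`_n.-1) = 0.
  by case: eqP => // _; rewrite !coefD !coefCM !coef_theta z ?leq_pred// !mulr0 !addr0.
rewrite !addr0 !coef_theta => /eqP; rewrite !mulf_eq0 => /orP[|/orP[|/eqP//]];
  rewrite -(dvdn_pcharf pF) => /dvdn_leq; lia.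
Qed.

End LevelSix.

Lemma odd_prime_halfE p : prime p -> (2 < p)%N -> p = (2 * p./2).+1.
Proof.
move=> p_prime p2; have := odd_double_half p.
by case: (even_prime p_prime) => [pE|->]; [rewrite pE in p2 | rewrite mul2n].
Qed.

(** * The hypergeometric solution and the comparison of top coefficients *)

Section Decision.
Variables (p : nat) (p_prime : prime p) (p_gt3 : (3 < p)%N).
Local Notation F := 'F_p.
Local Notation A := (aperyp p).
Local Notation P := (quad6 F).
Local Notation m := (p %/ 3)%N.

Let pF : p \in [pchar F] := pchar_Fp p_prime.

Let nz k : (0 < k < p)%N -> k%:R != 0 :> F.
Proof. move=> kp; rewrite -(dvdn_pcharf pF); apply/negP => /dvdn_leq; lia. Qed.

Let p_gt2 : (2 < p)%N := ltnW p_gt3.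

Let oddp : p = (2 * p./2).+1 := odd_prime_halfE p_prime p_gt2.

Let predp : p.-1 = (2 * p./2)%N := congr1 predn oddp.

Let half_gt0 : (0 < p./2)%N.
Proof. by rewrite half_gt0 (ltn_trans _ p_gt3). Qed.

Let pred_m1 : p.-1%:R = -1 :> {poly F}.
Proof.
apply/eqP; rewrite -addr_eq0 natr1 prednK ?prime_gt0//.
by rewrite -polyC_natr (pcharf0 pF).
Qed.

Let mE : p = (3 * m).+1 \/ p = (3 * m).+2.
Proof.
have : ~~ (3 %| p)%N by rewrite dvdn_prime2//; apply/eqP; lia.
rewrite /dvdn; have := divn_eq p 3; have : (p %% 3 < 3)%N by rewrite ltn_mod.
lia.
Qed.

(** Modulo [p], [m] is [-1/3] or [-2/3] according to [p] modulo 3, and [m (m + 1) = -2/9] either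
    way. *)
Let m_quad : 9%:R * m%:R * (m%:R + 1) = -2%:R :> F.
Proof.
have p0 := pcharf0 pF.
case: mE => pE.
  have e : 3%:R * m%:R = -1 :> F.
    by apply/eqP; rewrite -addr_eq0 -natrM natr1 -pE p0.
  transitivity ((3%:R * m%:R) * (3%:R * m%:R + 3%:R) : F); first by ring.
  by rewrite e; ring.
have e : 3%:R * m%:R = -2%:R :> F.
  by apply/eqP; rewrite -addr_eq0 -natrM -natrD addn2 -pE p0.
transitivity ((3%:R * m%:R) * (3%:R * m%:R + 3%:R) : F); first by ring.
by rewrite e; ring.
Qed.

(** Modulo [p], the coefficient of ['X^j] is [(3 j)! / j! ^ 3]. *)
Let T : {poly F} := \poly_(j < m.+1) ((-27%:R) ^+ j * ('C(m, j) * 'C(m + j, j))%:R).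

Let T_coef j : T`_j = (-27%:R) ^+ j * ('C(m, j) * 'C(m + j, j))%:R.
Proof.
by rewrite coef_poly ltnS; case: leqP => // mj; rewrite bin_small// mul0n mulr0.
Qed.

(** The equation of the hypergeometric series [2F1(1/3, 2/3; 1; 27 x)]: by [m_quad],
    [(m - j) (m + j + 1)] is [- (j + 1/3) (j + 2/3)]. The factor [m - j] makes the solution
    terminate. *)
Let T_ode : theta (theta T) =
  'X * (27%:R%:P * theta (theta T) + 27%:R%:P * theta T + 6%:R%:P * T).
Proof.
apply/polyP => -[|j]; rewrite coefXM coef_theta ?mul0r//= !coefD !coefCM !coef_theta !T_coef.
have [jm|mj] := leqP j m; last first.
  by rewrite !(@bin_small m)// ?mul0n; [ring|lia].
have h : j.+1%:R * (j.+1%:R * ('C(m, j.+1) * 'C(m + j.+1, j.+1))%:R) =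
  (m%:R - j%:R) * (m%:R + j%:R + 1) * ('C(m, j) * 'C(m + j, j))%:R :> F.
  rewrite -natrB// -(natrD _ m j) natr1 -!natrM; congr (_%:R).
  transitivity ((j.+1 * 'C(m, j.+1)) * (j.+1 * 'C(m + j.+1, j.+1)))%N; first by ring.
  by rewrite mul_bin_left addnS -mul_bin_diag; ring.
rewrite exprS.
transitivity (- 27%:R * (-27%:R) ^+ j * (j.+1%:R * (j.+1%:R * ('C(m, j.+1) * 'C(m + j.+1, j.+1))%:R)) : F).
  by ring.
rewrite h.
transitivity ((27%:R * (j%:R * j%:R + j%:R) - 3%:R * (9%:R * m%:R * (m%:R + 1))) *
   ((- 27%:R) ^+ j * ('C(m, j) * 'C(m + j, j))%:R) : F); first by ring.
by rewrite m_quad; ring.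
Qed.

Let X3 : {poly F} := 'X ^+ 2 * (1 - 8%:R * 'X).
Let Y : {poly F} := 1 - 6%:R * 'X.
(** For [k] of degree at most [m] this is [Y^(p-1) k(X3 / Y^3)]; the first factor fills the degree
    up to [p - 1]. *)
Let H k : {poly F} := Y ^+ (p.-1 - 3 * m) * homog X3 (Y ^+ 3) m k.

Let Y0 : Y`_0 = 1.
Proof. by rewrite /Y coefB coef1 mulr_natl coefMn coefX mul0rn subr0. Qed.

Let Yn0 : Y != 0.
Proof. by apply/eqP => y0; have := Y0; rewrite y0 coef0 => /esym/eqP; rewrite oner_eq0. Qed.

Let c80 : (1 - 8%:R * 'X) * Y != 0 :> {poly F}.
Proof.
rewrite mulf_neq0//; apply/eqP => /(congr1 (fun q : {poly F} => q`_0)).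
rewrite coefB coef1 mulr_natl coefMn coefX mul0rn subr0 coef0 => /eqP.
by rewrite oner_eq0.
Qed.

Let X3n0 : X3 != 0.
Proof.
rewrite /X3 mulf_neq0 ?expf_neq0 ?polyX_eq0//.
by apply: contraNneq c80 => ->; rewrite mul0r.
Qed.

(** The chain rule: [X3 / Y^3] has logarithmic Euler derivative [2 (1 - 9 z) / ((1 - 8 z) Y)], and
    [Y^(p-1)] has [6 z / Y] because [p - 1 = -1]. *)
Let theta_H k : (1 - 8%:R * 'X) * Y * theta (H k) =
  2%:R * (1 - 9%:R * 'X) * H (theta k) + 6%:R * 'X * (1 - 8%:R * 'X) * H k.
Proof.
have tY : theta Y = - (6%:R * 'X).
  by rewrite /Y thetaD thetaN thetaM thetaX theta_nat (theta_nat _ 1%N); ring.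
have tX3 : theta X3 = 'X ^+ 2 * (2%:R - 24%:R * 'X).
  rewrite /X3 expr2 !thetaM thetaD thetaN thetaM thetaX theta_nat (theta_nat _ 1%N); ring.
have h := theta_homog X3 (Y ^+ 3) m k.
have tY3 : theta (Y ^+ 3) = 3%:R * Y ^+ 2 * theta Y.
  rewrite !exprS expr0 !thetaM (theta_nat _ 1%N); ring.
have r := theta_exp Y (p.-1 - 3 * m).
rewrite /H; set k0 := homog _ _ _ k in h *; set k1 := homog _ _ _ (theta k) in h *.
set y := Y ^+ (p.-1 - 3 * m) in r *.
have N1 : (p.-1 - 3 * m)%:R = -1 - 3%:R * m%:R :> {poly F}.
  rewrite natrB ?natrM ?pred_m1//; case: mE; lia.
apply: (mulfI (_ : 'X ^+ 2 * Y ^+ 2 != 0)).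
  by rewrite mulf_neq0// expf_neq0// polyX_eq0.
rewrite thetaM.
transitivity (X3 * Y ^+ 2 * (Y * theta y) * k0 + y * (X3 * Y ^+ 3 * theta k0)).
  by rewrite /X3; ring.
rewrite r h N1 tY3 tX3 tY /X3 /Y; ring.
Qed.

(** The homogenized [T_ode], combined with [Y^3 - 27 X3 = (1 - 9 z)^2]. *)
Let H_hyp : (1 - 9%:R * 'X) ^+ 2 * H (theta (theta T)) =
  X3 * (27%:R * H (theta T) + 6%:R * H T).
Proof.
have sz (a : {poly F}) : (size a <= m.+1)%N -> (size (theta a) <= m.+1)%N.
  by move=> am; apply: leq_trans (size_poly _ _) am.
have sT : (size T <= m.+1)%N by exact: size_poly.
have Y3 : Y ^+ 3 != 0 by rewrite expf_neq0.
have := congr1 (homog X3 (Y ^+ 3) (1 + m)) T_ode.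
rewrite homogM// ?size_polyX//; last first.
  rewrite (leq_trans (size_polyD _ _))// geq_max (leq_trans (size_polyD _ _)) ?geq_max;
  rewrite ?mul_polyC ?(leq_trans (size_scale_leq _ _))// ?sz// ?sz//.
rewrite -[theta (theta T) in LHS]mul1r homogM ?size_poly1// ?sz ?sz//.
rewrite homog1 homogX !homogD !homogZ => e.
rewrite /H; set y := Y ^+ (p.-1 - 3 * m).
set h0 := homog _ _ _ T in e *; set h1 := homog _ _ _ (theta T) in e *.
set h2 := homog _ _ _ (theta (theta T)) in e *.
have -> : (1 - 9%:R * 'X) ^+ 2 = Y ^+ 3 - 27%:R * X3 by rewrite /Y /X3; ring.
transitivity (y * (Y ^+ 3 * h2) - 27%:R * X3 * (y * h2)); first by ring.
by rewrite e !polyC_natr; ring.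
Qed.

(** Eliminating derivatives through [theta_H] turns [c ^+ 2 * op6 (H T)] into [4 P] times the
    relation [H_hyp]. *)
Let H_op6 : op6 (H T) = 0.
Proof.
set h0 := H T; set h1 := H (theta T); set h2 := H (theta (theta T)).
pose c : {poly F} := (1 - 8%:R * 'X) * Y.
have e0 : c * theta h0 = 2%:R * (1 - 9%:R * 'X) * h1 + 6%:R * 'X * (1 - 8%:R * 'X) * h0.
  exact: theta_H.
have e1 : c * theta h1 = 2%:R * (1 - 9%:R * 'X) * h2 + 6%:R * 'X * (1 - 8%:R * 'X) * h1.
  exact: theta_H.
have e2 : (1 - 9%:R * 'X) ^+ 2 * h2 = X3 * (27%:R * h1 + 6%:R * h0) by exact: H_hyp.
have tc : theta c = 96%:R * 'X ^+ 2 - 14%:R * 'X.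
  rewrite /c /Y thetaM !thetaD !thetaN !thetaM thetaX !theta_nat !(theta_nat _ 1%N); ring.
have cE : c = (1 - 8%:R * 'X) * Y by [].
have c0 : c ^+ 2 != 0 by rewrite expf_neq0.
clearbody c h0 h1 h2.
have e3 : c * theta (theta h0) = (6%:R * 'X * (1 - 8%:R * 'X) - theta c) * theta h0
  + 2%:R * (1 - 9%:R * 'X) * theta h1 - 18%:R * 'X * h1
  + (6%:R * 'X - 96%:R * 'X ^+ 2) * h0.
  have := congr1 (@theta F) e0.
  rewrite !(theta_nat, theta_nat _ 1%N, thetaX, thetaM, thetaN, thetaD) => e.
  transitivity ((theta c * theta h0 + c * theta (theta h0)) - theta c * theta h0); first by ring.
  by rewrite e; ring.
apply: (mulfI c0); rewrite mulr0 /op6.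
transitivity (P * c * (c * theta (theta h0)) + theta P * c * (c * theta h0)
  + (72%:R * 'X ^+ 2 - 6%:R * 'X) * c ^+ 2 * h0); first by ring.
rewrite e3.
transitivity (P * ((6%:R * 'X * (1 - 8%:R * 'X) - theta c) * (c * theta h0)
  + 2%:R * (1 - 9%:R * 'X) * (c * theta h1) + c * (- 18%:R * 'X * h1
  + (6%:R * 'X - 96%:R * 'X ^+ 2) * h0)) + theta P * c * (c * theta h0)
  + (72%:R * 'X ^+ 2 - 6%:R * 'X) * c ^+ 2 * h0); first by ring.
rewrite e0 e1 tc.
transitivity (4%:R * P * ((1 - 9%:R * 'X) ^+ 2 * h2 - X3 * (27%:R * h1 + 6%:R * h0))).
  by rewrite theta_quad6 cE /X3 /Y /quad6; ring.
by rewrite e2 subrr mulr0.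
Qed.

Let H_0 : (H T)`_0 = 1.
Proof.
have cX (q : {poly F}) k : (q ^+ k)`_0 = q`_0 ^+ k.
  by rewrite -!horner_coef0 horner_exp.
rewrite /H coef0M cX Y0 expr1n mul1r coef0_homog ?cX ?Y0 ?expr1n//.
  by rewrite T_coef !bin0 mul1r.
by rewrite /X3 coef0M cX coefX expr0n mul0r.
Qed.

(** Since [(-27) (-8) = - (-6)^3] and [(-6)^(p-1) = 1], the top coefficient collapses to the sum in
    [sum_bin_alternating]. *)
Let H_top : deg_top p.-1 (H T) ((-1) ^+ m).
Proof.
have lin (c : F) : deg_top 1 (1 - c%:P * 'X) (- c).
  split; last by rewrite coefB coef1 coefCM coefX sub0r mulr1.
  by apply/leq_sizeP => -[|[|j]]// _; rewrite coefB coef1 coefCM coefX mulr0 subr0.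
have X2 : deg_top 2 ('X ^+ 2 : {poly F}) 1 by split; rewrite ?size_polyXn ?coefXn.
have dX3 : deg_top 3 X3 (- 8%:R).
  by have := deg_topM X2 (lin 8%:R); rewrite mul1r polyC_natr.
have dY : deg_top 1 Y (- 6%:R) by have := lin 6%:R; rewrite polyC_natr.
have dY3 : deg_top 3 (Y ^+ 3) ((- 6%:R) ^+ 3) by exact: (deg_topX 3 dY).
have := deg_topM (deg_topX (p.-1 - 3 * m) dY) (deg_top_homog m T dX3 dY3).
rewrite mul1n subnK; last by case: mE; lia.
congr deg_top; rewrite mulr_sumr -(sum_bin_alternating F m).
apply: eq_bigr => -[j jm] _ /=; rewrite T_coef.
have six : (- 6%:R : F) != 0.
  by rewrite oppr_eq0 (natrM _ 2 3) mulf_neq0// nz.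
have fermat : (- 6%:R : F) ^+ p.-1 = 1.
  by apply: (mulfI six); rewrite -exprS prednK ?prime_gt0// Fp_fermat// mulr1.
set C := (_ * _)%:R; set u := (-6%:R) ^+ (p.-1 - 3 * m); set v := (_ ^+ 3) ^+ (m - j).
have e1 : (-6%:R) ^+ (3 * j) * v * u = 1 :> F.
  rewrite /v /u -exprM -!exprD -[RHS]fermat; congr (_ ^+ _).
  by move: (m) mE jm => n; lia.
have e2 : (- 27%:R) ^+ j * (- 8%:R) ^+ j = (-1) ^+ j * (-6%:R) ^+ (3 * j) :> F.
  by rewrite exprM -!exprMn; congr (_ ^+ _); ring.
transitivity (((- 27%:R) ^+ j * (- 8%:R) ^+ j) * (v * u) * C); first by ring.
rewrite e2; transitivity ((-1) ^+ j * ((-6%:R) ^+ (3 * j) * v * u) * C); first by ring.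
by rewrite e1 mulr1.
Qed.

Let quad6_0 : P`_0 = 1.
Proof.
rewrite /quad6 coefD coefB coef1 !mulr_natl !coefMn coefX coefXn.
by rewrite !mul0rn subr0 addr0.
Qed.

Let quad6_n0 : P != 0.
Proof. by apply/eqP => y0; have := quad6_0; rewrite y0 coef0 => /esym/eqP; rewrite oner_eq0. Qed.

Local Notation hom := (homog (- 'X) P).

Let hom2_11 : hom 2 (1 * 1) = P * P.
Proof. by rewrite (@homogM _ _ _ 1 1) ?size_poly1// homog1. Qed.

Let hom2_1X : hom 2 (1 * 'X) = P * - 'X.
Proof. by rewrite (@homogM _ _ _ 1 1) ?size_poly1 ?size_polyX// homog1 homogX. Qed.

Let hom2_XX : hom 2 ('X * 'X) = 'X ^+ 2.
Proof. by rewrite (@homogM _ _ _ 1 1) ?size_polyX// homogX -expr2 sqrrN. Qed.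

Let hom_disc : hom 2 (disc 'X) = (1 - 72%:R * 'X ^+ 2) ^+ 2.
Proof.
have e : disc 'X = 1 * 1 + (- 34%:R)%:P * (1 * 'X) + 'X * 'X :> {poly F}.
  by rewrite /disc polyCN polyC_natr; ring.
rewrite e !homogD (homogZ _ _ _ (- 34%:R)) hom2_11 hom2_1X hom2_XX.
by rewrite polyCN polyC_natr /quad6; ring.
Qed.

(** Pulls [apery_form_aperyp] back along [t = - z / P]; in the end [P ^+ 2] times the claim is [P]
    times the homogenized equation [main]. *)
Let form6_hom : form6 (hom p.-1 A) = 0.
Proof.
have sA : (size A <= p.-1.+1)%N by rewrite prednK ?prime_gt0 ?size_aperyp.
have sz (a : {poly F}) : (size a <= p.-1.+1)%N -> (size (theta a) <= p.-1.+1)%N.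
  by move=> am; apply: leq_trans (size_poly _ _) am.
(* The logarithmic Euler derivative of [t] is [(1 - 72 z^2) / P], and [p - 1 = -1] in the field. *)
have tP (a : {poly F}) : P * theta (hom p.-1 a) =
    (1 - 72%:R * 'X ^+ 2) * hom p.-1 (theta a) - theta P * hom p.-1 a.
  have := theta_homog (- 'X) P p.-1 a; rewrite thetaN thetaX pred_m1 => e.
  apply: (mulfI (_ : - 'X != 0)); first by rewrite oppr_eq0 polyX_eq0.
  rewrite [LHS]mulrA e.
  by rewrite theta_quad6 /quad6; ring.
set W := hom p.-1 A; set W1 := hom p.-1 (theta A); set W2 := hom p.-1 (theta (theta A)).
have t0 : P * theta W = (1 - 72%:R * 'X ^+ 2) * W1 - theta P * W by exact: tP.
have t1 : P * theta W1 = (1 - 72%:R * 'X ^+ 2) * W2 - theta P * W1 by exact: tP.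
have main : (1 - 72%:R * 'X ^+ 2) ^+ 2 * (2%:R * W * W2 - W1 ^+ 2)
  + (2%:R * 'X ^+ 2 + 34%:R * 'X * P) * W * W1 + ('X ^+ 2 + 10%:R * 'X * P) * W ^+ 2 = 0.
  have M (a b : {poly F}) : (size a <= p.-1.+1)%N -> (size b <= p.-1.+1)%N ->
    hom (p.-1 + p.-1) (a * b) = hom p.-1 a * hom p.-1 b by exact: homogM.
  have M2 (a b : {poly F}) : (size a <= 3)%N -> (size b <= (p.-1 + p.-1).+1)%N ->
    hom (2 + (p.-1 + p.-1)) (a * b) = hom 2 a * hom (p.-1 + p.-1) b by exact: homogM.
  have sM (a b : {poly F}) : (size a <= p.-1.+1)%N -> (size b <= p.-1.+1)%N ->
    (size (a * b)%R <= (p.-1 + p.-1).+1)%N.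
    exact: size_mulp_leq.
  have sC (c : F) (a : {poly F}) N : (size a <= N)%N -> (size (c%:P * a)%R <= N)%N.
    by move=> ha; rewrite mul_polyC (leq_trans (size_scale_leq _ _)).
  have sD (a b : {poly F}) N : (size a <= N)%N -> (size b <= N)%N -> (size (a + b)%R <= N)%N.
    by move=> ha hb; rewrite (leq_trans (size_polyD _ _))// geq_max ha.
  have e : disc 'X * (2%:R%:P * (A * theta (theta A)) + (-1)%:P * (theta A * theta A))
    + (2%:R%:P * ('X * 'X) + (- 34%:R)%:P * (1 * 'X)) * (A * theta A)
    + ('X * 'X + (- 10%:R)%:P * (1 * 'X)) * (A * A) = 0.
    rewrite -(apery_form_aperyp p_prime) /apery_form !polyCN !polyC_natr polyC1; ring.
  have := congr1 (hom (2 + (p.-1 + p.-1))) e.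
  have X2 : (size ('X * 'X : {poly F})%R <= 3)%N by rewrite -expr2 size_polyXn.
  have X1 : (size (1 * 'X : {poly F})%R <= 3)%N by rewrite mul1r size_polyX.
  have sdisc : (size (disc 'X : {poly F}) <= 3)%N.
    have -> : disc 'X = 1 + ((- 34%:R)%:P * (1 * 'X) + 'X * 'X) :> {poly F}.
      by rewrite /disc polyCN polyC_natr; ring.
    by apply: (sD); [rewrite size_poly1 | apply: (sD) => //; exact: (sC)].
  have sA1 := sz _ sA; have sA2 := sz _ sA1.
  rewrite !homogD !M2 ?hom_disc; do ?[by [] | apply: (sD) | apply: (sC) | apply: (sM)].
  rewrite !homogD !(homogZ _ _ _ 2%:R) !(homogZ _ _ _ (-1)).
  rewrite (homogZ _ _ _ (- 34%:R)) (homogZ _ _ _ (- 10%:R)).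
  rewrite hom2_XX hom2_1X !M//.
  rewrite -/W -/W1 -/W2 !polyCN !polyC_natr polyC1.
  have -> : hom (2 + (p.-1 + p.-1)) 0 = 0.
    by rewrite /homog big1// => i _; rewrite coef0 scale0r.
  by move=> <-; ring.
have t2 : P * theta (theta W) = - 144%:R * 'X ^+ 2 * W1 + (1 - 72%:R * 'X ^+ 2) * theta W1
  - theta (theta P) * W - 2%:R * theta P * theta W.
  have tk : theta (1 - 72%:R * 'X ^+ 2) = - 144%:R * 'X ^+ 2 :> {poly F}.
    rewrite expr2 !(theta_nat, theta_nat _ 1%N, thetaX, thetaM, thetaN, thetaD); ring.
  have := congr1 (@theta F) t0.
  rewrite (thetaM P) (thetaD (_ * W1)) (thetaN (_ * W)) (thetaM _ W1) (thetaM (theta P) W) tk => e.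
  transitivity ((theta P * theta W + P * theta (theta W)) - theta P * theta W); first by ring.
  by rewrite e; ring.
have ttP : theta (theta P) = 288%:R * 'X ^+ 2 - 17%:R * 'X.
  by rewrite theta_quad6 expr2 !thetaD thetaN !thetaM thetaX !theta_nat; ring.
apply: (mulfI (_ : P ^+ 2 != 0)); first by rewrite expf_neq0.
rewrite mulr0 /form6.
transitivity (P * (2%:R * W * (P * (P * theta (theta W))) - (P * theta W) ^+ 2)
  + 2%:R * P * theta P * W * (P * theta W)
  + 4%:R * (72%:R * 'X ^+ 2 - 6%:R * 'X) * P ^+ 2 * W ^+ 2); first by ring.
rewrite t2.
transitivity (P * (2%:R * W * (P * (- 144%:R * 'X ^+ 2 * W1 - theta (theta P) * W)
   + (1 - 72%:R * 'X ^+ 2) * (P * theta W1) - 2%:R * theta P * (P * theta W)) - (P * theta W) ^+ 2)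
  + 2%:R * P * theta P * W * (P * theta W)
  + 4%:R * (72%:R * 'X ^+ 2 - 6%:R * 'X) * P ^+ 2 * W ^+ 2); first by ring.
rewrite t0 t1 ttP; rewrite -[RHS](mulr0 P) -main theta_quad6 /quad6; ring.
Qed.

Let sqrt_top (G : {poly F}) c : G ^+ 2 = hom p.-1 A -> G`_0 = 1 ->
  deg_top p.-1 G c -> c = (-1) ^+ m.
Proof.
move=> G2 G0 [sG <-].
have GH : G = H T.
  apply/eqP; rewrite -subr_eq0; apply/eqP; apply: (op6_unique pF).
  - rewrite (leq_trans (size_polyD _ _))// size_polyN geq_max.
    by move: sG H_top.1; rewrite prednK ?prime_gt0// => -> ->.
  - rewrite op6B H_op6 subr0.
    have := form6_hom; rewrite -G2 form6_sqr => /eqP; rewrite mulf_eq0 mulf_eq0.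
    have -> : (4%:R == 0 :> {poly F}) = false.
      by rewrite -polyC_natr polyC_eq0; apply/negbTE; rewrite (natrM _ 2 2) mulf_neq0// nz.
    have -> : (G ^+ 3 == 0) = false.
      apply/negbTE; rewrite expf_neq0//; apply: contra_eq_neq G0 => ->.
      by rewrite coef0 eq_sym oner_eq0.
    by move/eqP.
  - by rewrite coefB G0 H_0 subrr.
by rewrite GH H_top.2.
Qed.

Let P_top : deg_top 2 P 72%:R.
Proof.
have e : P = 72%:R%:P * 'X ^+ 2 + ((-17%:R)%:P * 'X + 1).
  by rewrite /quad6 polyCN !polyC_natr; ring.
rewrite e; split; last first.
  by rewrite !coefD !coefCM coefXn coefX coef1 /= mulr1 mulr0 !addr0.
apply/leq_sizeP => -[|[|[|j]]]// _.
by rewrite !coefD !coefCM coefXn coefX coef1 /= !mulr0 !addr0.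
Qed.

Let X_top : deg_top 2 (- 'X : {poly F}) 0.
Proof.
split; last by rewrite coefN coefX oppr0.
by rewrite size_polyN size_polyX.
Qed.

(** In degree 2 the numerator [- z] has top coefficient 0, so only the constant term of [B]
    contributes. *)
Let hom_top N (B : {poly F}) : B`_0 = 1 -> deg_top (2 * N) (hom N B) (72%:R ^+ N).
Proof.
move=> B0; have := deg_top_homog N B X_top P_top; congr deg_top.
rewrite big_ord_recl B0 !mul1r subn0 big1 ?addr0// => i _.
by rewrite exprS !mul0r mulr0.
Qed.

(** [72 = 2 * 6^2], and [6^(p-1) = 1]. *)
Let natr72 : 72%:R ^+ p./2 = 2%:R ^+ p./2 :> F.
Proof.
have six : (6%:R : F) != 0 by rewrite (natrM _ 2 3) mulf_neq0// nz.
have fermat : (6%:R : F) ^+ p.-1 = 1.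
  by apply: (mulfI six); rewrite -exprS prednK ?prime_gt0// Fp_fermat// mulr1.
rewrite (natrM _ 2 36) (natrM _ 6 6) -expr2 exprMn -exprM.
by rewrite -predp fermat mulr1.
Qed.

Lemma aperyp_sqr (B : {poly F}) : B`_0 = 1 -> A = B ^+ 2 ->
  2%:R ^+ p./2 = (-1) ^+ (p %/ 3) :> F.
Proof.
move=> B0 AB; rewrite -natr72; apply: (sqrt_top (G := hom p./2 B)).
- have sB : (size B <= p./2.+1)%N.
    have := size_exp B 2; rewrite -AB size_aperyp// predp muln2 -mul2n => /eqP.
    by rewrite eqn_pmul2l// => /eqP ->; exact: leqSpred.
  by rewrite AB predp mul2n -addnn !expr2 homogM.
- by rewrite coef0_homog// coefN coefX oppr0.
- by rewrite predp; exact: hom_top.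
Qed.

(** By [hom_disc] the square root acquires the factor [1 - 72 z^2], whose top coefficient [- 72]
    causes the change of sign. *)
Lemma aperyp_disc_sqr (B : {poly F}) : B`_0 = 1 -> A = disc 'X * B ^+ 2 ->
  - 2%:R ^+ p./2 = (-1) ^+ (p %/ 3) :> F.
Proof.
move=> B0 AB; rewrite -natr72.
have predpE : p.-1 = (2 + (p./2.-1 + p./2.-1))%N.
  by rewrite predp -{1}(prednK half_gt0) mul2n -addnn addSn addnS.
apply: (sqrt_top (G := (1 - 72%:R * 'X ^+ 2) * hom p./2.-1 B)).
- have A_n0 : A != 0 by rewrite -size_poly_gt0 size_aperyp// prime_gt0.
  have D_n0 : disc 'X != 0 :> {poly F}.
    by apply: contraNneq A_n0; rewrite AB => ->; rewrite mul0r.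
  have B2_n0 : B ^+ 2 != 0.
    by apply: contraNneq A_n0; rewrite AB => ->; rewrite mulr0.
  have sD := size_disc F.
  have sB : (size B <= p./2.-1.+1)%N.
    have := congr1 (fun a : {poly F} => (size a).-1) AB.
    rewrite size_aperyp// size_mul// sD -[size (B ^+ 2)]prednK ?size_poly_gt0//.
    rewrite size_exp predpE /= addnn -muln2 => /eqP.
    by rewrite eqn_add2l eqn_pmul2r// => /eqP ->; exact: leqSpred.
  by rewrite exprMn -hom_disc AB predpE !expr2 -homogM// -homogM ?sD// size_mulp_leq.
- rewrite coef0M coef0_homog ?coefN ?coefX ?oppr0// B0 mulr1.
  by rewrite coefB coef1 mulr_natl coefMn coefXn mul0rn subr0.
have K : deg_top 2 (1 - 72%:R * 'X ^+ 2 : {poly F}) (- 72%:R).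
  rewrite -polyC_natr; split; last by rewrite coefB coef1 coefCM coefXn mulr1 sub0r.
  by apply/leq_sizeP => -[|[|[|j]]]// _; rewrite coefB coef1 coefCM coefXn mulr0 subr0.
have := deg_topM K (hom_top p./2.-1 B0); rewrite mul2n -addnn -predpE.
by rewrite mulNr -exprS prednK.
Qed.

End Decision.

(** * Evaluation of the signs modulo 24 *)

Section Mod24.
Variables (p : nat) (p_prime : prime p).
Local Notation F := 'F_p.

Let sign_neq : (3 < p)%N -> 1 != -1 :> F.
Proof.
move=> p3; rewrite -addr_eq0 -(natrD _ 1 1) -(dvdn_pcharf (pchar_Fp p_prime)).
by apply/negP => /dvdn_leq; lia.
Qed.

Lemma sign_third_mod24 r : (p %% 24)%N = r ->
  (-1) ^+ (p %/ 3) = (-1) ^+ (odd (r %/ 3)) :> F.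
Proof.
move=> pr; rewrite -signr_odd; congr ((-1) ^+ (nat_of_bool _)).
rewrite {1}(divn_eq p 24) pr (_ : p %/ 24 * 24 = p %/ 24 * 8 * 3)%N ?divnMDl//; last by lia.
by rewrite oddD oddM andbF.
Qed.

Lemma mod24_mod8 r : (p %% 24)%N = r -> (p %% 8)%N = (r %% 8)%N.
Proof. by move=> <-; rewrite modn_dvdm. Qed.

Lemma natr2_exp_half_mod24 : (p %% 24)%N \in [:: 1; 5; 7; 11; 13; 17; 19; 23]%N ->
  (2%:R : F) ^+ p./2 =
  (if (p %% 24)%N \in [:: 1; 5; 7; 11]%N then 1 else -1) * (-1) ^+ (p %/ 3).
Proof.
move=> pr; have p2 : (2 < p)%N.
  by have := prime_gt1 p_prime; rewrite leq_eqVlt => /orP[/eqP p2|//]; rewrite -p2 in pr.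
rewrite natr2_exp_half//; move: pr; rewrite !inE.
by do 7?[case/orP]; move=> /eqP pr; rewrite (mod24_mod8 pr) (sign_third_mod24 pr) pr /=
  ?expr0 ?expr1 ?mulr1 ?mulrN1 ?opprK.
Qed.

Lemma mod24_gt3 :
  (p %% 24)%N \in [:: 1; 5; 7; 11; 13; 17; 19; 23]%N -> (3 < p)%N.
Proof.
move=> pr; rewrite ltnNge; apply/negP => p3.
have [p2|{}p3] : p = 2%N \/ p = 3%N by have := prime_gt1 p_prime; lia.
  by move: pr; rewrite p2.
by move: pr; rewrite p3.
Qed.

(** In these classes the shape [D B^2] would give [1 = -1]. *)
Lemma aperyp_is_sqr : (p %% 24)%N \in [:: 1; 5; 7; 11]%N ->
  exists B : {poly F}, aperyp p = B ^+ 2.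
Proof.
move=> pr; have pr8 : (p %% 24)%N \in [:: 1; 5; 7; 11; 13; 17; 19; 23]%N.
  by move: pr; rewrite !inE; do 3?[case/orP]; move=> ->; rewrite ?orbT.
have p3 := mod24_gt3 pr8.
have [B [B0 [|AB]]] := aperyp_shape p_prime p3; first by exists B.
have := aperyp_disc_sqr p_prime p3 B0 AB.
rewrite natr2_exp_half_mod24// pr mul1r -mulN1r -{2}[_ ^+ (p %/ 3)]mul1r => /(mulIf _) e.
have := sign_neq p3; rewrite e ?eqxx// signr_eq0//.
Qed.

Lemma aperyp_not_sqr (g : {poly F}) :
  (p %% 24)%N \in [:: 13; 17; 19; 23]%N -> aperyp p <> g ^+ 2.
Proof.
move=> pr Ag; have pr8 : (p %% 24)%N \in [:: 1; 5; 7; 11; 13; 17; 19; 23]%N.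
  by move: pr; rewrite !inE; do 3?[case/orP]; move=> ->; rewrite ?orbT.
have npr : ((p %% 24)%N \in [:: 1; 5; 7; 11]%N) = false.
  by move: pr; rewrite !inE; do 3?[case/orP]; move=> /eqP ->.
have p3 := mod24_gt3 pr8.
have g0 : g`_0 ^+ 2 = 1 by rewrite -(aperyp0 p_prime) Ag expr2 coef0M.
have gn0 : g`_0 != 0 by apply: contra_eq_neq g0 => ->; rewrite expr0n eq_sym oner_eq0.
(* The constant term of [g] squares to 1, so normalizing it leaves [g ^+ 2] unchanged. *)
have := @aperyp_sqr p p_prime p3 ((g`_0)^-1 *: g).
rewrite coefZ mulVf// exprZn exprVn g0 invr1 scale1r => /(_ erefl Ag).
rewrite natr2_exp_half_mod24// npr -{2}[_ ^+ (p %/ 3)]mul1r => /(mulIf _) e.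
have := sign_neq p3; rewrite e ?eqxx// signr_eq0//.
Qed.

End Mod24.

(** * Kummer extensions *)

Lemma horner_map_scale (K L : fieldType) (i : {rmorphism K -> L})
  (q : {poly K}) k y :
  (map_poly i (q \Po (k%:P * 'X))).[y] = (map_poly i q).[i k * y].
Proof.
by rewrite map_comp_poly rmorphM /= map_polyC map_polyX horner_comp !hornerE.
Qed.

Section KummerPoly.
Variables (F : finFieldType) (L : fieldType) (c : {rmorphism F -> L}).
Local Notation N := (#|F|.-1).

Lemma unit_exp_card (u : {unit F}) : (val u) ^+ N = 1.
Proof.
apply: (mulfI (_ : val u != 0)); first by rewrite -unitfE; exact: valP.
by rewrite -exprS prednK ?expf_card ?mulr1//; exact: ltnW (finNzRing_gt1 F).
Qed.

(** The units of [F] supply [N] distinct [N]-th roots of unity in [L]. *)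
Lemma Xn_sub_expn (g : L) : g != 0 ->
  'X^N - (g ^+ N)%:P = \prod_(u : {unit F}) ('X - (c (val u) * g)%:P).
Proof.
move=> g0; have N0 : (0 < N)%N by have := finNzRing_gt1 F; rewrite -subn1 subn_gt0.
pose rs := [seq c (val u) * g | u <- index_enum {unit F}].
have inj : injective (fun u : {unit F} => c (val u) * g).
  by move=> u v /(mulIf g0) /fmorph_inj /val_inj.
have sz : size rs = N.
  by rewrite size_map -card_finField_unit cardsT cardE enumT.
have := @all_roots_prod_XsubC _ ('X^N - (g ^+ N)%:P) rs.
rewrite size_XnsubC// sz => /(_ erefl).
rewrite lead_coefXnsubC// scale1r big_map; apply.
  apply/allP => _ /mapP[u _ ->]; rewrite rootE !hornerE exprMn -rmorphXn.
  by rewrite unit_exp_card rmorph1 mul1r subrr.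
by rewrite uniq_rootsE map_inj_uniq// index_enum_uniq.
Qed.

Lemma expn_eq_unit (x g : L) : g != 0 -> x ^+ N = g ^+ N ->
  exists u : {unit F}, x = c (val u) * g.
Proof.
move=> g0 xg; have := congr1 (fun q => q.[x]) (Xn_sub_expn g0).
rewrite !hornerE xg subrr horner_prod => /esym/eqP/prodf_eq0[u _].
by rewrite !hornerE subr_eq0 => /eqP ->; exists u.
Qed.

End KummerPoly.

Section KummerExtension.
Variables (F : finFieldType) (K L : fieldType).
Variables (c : {rmorphism F -> K}) (i : {rmorphism K -> L}) (f : L) (n : nat).
Local Notation N := (#|F|.-1).
Local Notation ev q x := ((map_poly i q).[x]).
Hypotheses (f0 : f != 0) (n0 : (0 < n)%N).
Variables (a b : K) (fn : i a = f ^+ n) (fN : i b = f ^+ N).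
Hypothesis n_min : forall d k, (0 < d)%N -> i k = f ^+ d -> (n <= d)%N.

(** A nonzero annihilator of minimal degree [d] splits over [L] into factors
['X - u f] with [u] in [F], so its constant term puts [f ^+ d] in [K]. *)
Lemma kummer_free (q : {poly K}) : (size q <= n)%N -> ev q f = 0 -> q = 0.
Proof.
move=> qn qf; apply/eqP; apply/negP => /negP q0.
have ex : exists s, `[< exists m : {poly K}, [/\ size m = s, m != 0 & ev m f = 0] >].
  by exists (size q); apply/asboolP; exists q.
case: (ex_minnP ex) => s /asboolP[m [ms m0 mf]] smin.
have sn : (s <= n)%N.
  by apply: leq_trans qn; apply: smin; apply/asboolP; exists q.
have mdvd (r : {poly K}) : ev r f = 0 -> m %| r.
  move=> rf; apply/modp_eq0P/eqP; apply/negP => /negP r0.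
  have : (s <= size (r %% m)%R)%N.
    apply: smin; apply/asboolP; exists (r %% m); split=> //.
    move: rf; rewrite {1}(divp_eq r m) rmorphD rmorphM hornerD hornerM mf mulr0 add0r.
    by [].
  by rewrite -ms leqNgt ltn_modp m0.
have : m %| 'X^N - b%:P.
  by apply: mdvd; rewrite rmorphB /= map_polyXn map_polyC /= !hornerE fN subrr.
rewrite -(dvdp_map i) rmorphB /= map_polyXn map_polyC /= fN.
rewrite (Xn_sub_expn (i \o c) f0) => /dvdp_prod_XsubC[msk meq].
set us := mask msk _ in meq.
have /eqpP[[e1 e2] /= /andP[e10 e20] meq'] := meq.
have sus : size us = s.-1.
  have := eqp_size meq; rewrite size_map_poly ms size_prod_XsubC => ->.
  by [].
have s1 : (1 < s)%N.
  rewrite ltnNge -ms; apply/negP => /size1_polyC mC.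
  move: mf m0; rewrite mC map_polyC hornerC => /eqP; rewrite fmorph_eq0 => /eqP ->.
  by rewrite eqxx.
have const : exists2 k : K, k != 0 &
    (\prod_(u <- us) ('X - ((i \o c) (val u) * f)%:P))`_0 = i k * f ^+ s.-1.
  rewrite -sus; elim: us {meq meq' sus} => [|u us [k k0 IH]].
    by exists 1; rewrite ?oner_eq0// big_nil coef1 rmorph1 mulr1.
  exists (- c (val u) * k).
    by rewrite mulf_neq0// oppr_eq0 fmorph_eq0 -unitfE; exact: valP.
  rewrite big_cons coef0M IH coefB coefX coefC sub0r /= rmorphM rmorphN exprS.
  by ring.
have [k k0 kE] := const.
have e12 : e1 * i (lead_coef m) = e2.
  have := congr1 lead_coef meq'; rewrite !lead_coefZ lead_coef_map.
  by rewrite (monicP (monic_prod_XsubC _ _ _)) mulr1.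
have fs : f ^+ s.-1 = i (m`_0 / (lead_coef m * k)).
  have := congr1 (fun r : {poly L} => r`_0) meq'.
  rewrite !coefZ coef_map kE -e12 -mulrA => /(mulfI e10) e.
  rewrite rmorphM fmorphV rmorphM e.
  have i1 : i (lead_coef m) != 0 by rewrite fmorph_eq0 lead_coef_eq0.
  have i2 : i k != 0 by rewrite fmorph_eq0.
  by field; rewrite i1 i2.
(* The degree [s.-1] is positive and less than [n], against minimality. *)
have := n_min (_ : 0 < s.-1)%N (esym fs).
by move=> /(_ ltac:(lia)); lia.
Qed.

(** By [kummer_free] this is the minimal polynomial of [f] over [K]. *)
Let mu : {poly K} := 'X^n - a%:P.

Let mu_root x : x ^+ n = f ^+ n -> ev mu x = 0.
Proof. by move=> xf; rewrite rmorphB /= map_polyXn map_polyC /= !hornerE fn xf subrr. Qed.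

Let mu_neq0 : mu != 0.
Proof. by rewrite -size_poly_gt0 size_XnsubC. Qed.

Let mu_dvd (q : {poly K}) : ev q f = 0 -> mu %| q.
Proof.
move=> qf; apply/modp_eq0P; apply: kummer_free.
  by rewrite -ltnS -(size_XnsubC a n0) ltn_modp mu_neq0.
move: qf; rewrite {1}(divp_eq q mu) rmorphD rmorphM hornerD hornerM mu_root//.
by rewrite mulr0 add0r.
Qed.

(** Makes the substitution of [x] for [f] well defined on polynomial expressions in [f]. *)
Lemma kummer_conj (q : {poly K}) x : x ^+ n = f ^+ n -> ev q f = 0 -> ev q x = 0.
Proof.
move=> xf /mu_dvd /dvdpP[r ->].
by rewrite rmorphM hornerM mu_root// mulr0.
Qed.

(** Shows that [K[f]] is a field, by a Bezout relation with [mu]. If [q] does not vanish at [f],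
    neither does [gcdp q mu], so [mu] divides its cofactor and the gcd is constant. *)
Lemma kummer_inv (q : {poly K}) : exists w : {poly K}, ev w f = (ev q f)^-1.
Proof.
have [qf|qf] := eqVneq (ev q f) 0.
  by exists 0; rewrite qf invr0 rmorph0 horner0.
have /Bezout_eq1_coprimepP[[u v] /= uv] : coprimep q mu.
  rewrite /coprimep; set g := gcdp q mu.
  have /dvdpP[h muE] : g %| mu by exact: dvdp_gcdr.
  have /dvdpP[r qE] : g %| q by exact: dvdp_gcdl.
  have gf : ev g f != 0.
    by apply: contraNneq qf => gf; rewrite qE rmorphM hornerM gf mulr0.
  have h0 : h != 0 by apply: contraNneq mu_neq0; rewrite muE => ->; rewrite mul0r.
  have : mu %| h.
    apply: mu_dvd; have /eqP := mu_root (erefl (f ^+ n)).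
    by rewrite muE rmorphM hornerM mulf_eq0 (negPf gf) orbF => /eqP.
  move=> /(dvdp_leq h0); have g0 : g != 0.
    by apply: contraNneq gf => ->; rewrite rmorph0 horner0.
  rewrite muE size_mul//.
  have : (0 < size h)%N by rewrite size_poly_gt0.
  have : (0 < size g)%N by rewrite size_poly_gt0.
  by move: (size h) (size g) => s t; lia.
exists u; have := congr1 (fun r => ev r f) uv.
rewrite rmorphD !rmorphM hornerD !hornerM mu_root// mulr0 addr0 rmorph1 hornerC => e.
by rewrite -[LHS](mulfK qf) e mul1r.
Qed.

End KummerExtension.

(** * The field generated by the Apery series *)

Section GalMorphism.
Variables (E : fieldType) (K : {pred E}) (s : gal K).

Lemma gal_is_zmod_morphism : zmod_morphism s.
Proof.
have s0 : s 0 = 0 by apply: (addIr (s 0)); rewrite -gal_add !add0r.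
have sN x : s (- x) = - s x by apply: (addIr (s x)); rewrite -gal_add !addNr s0.
by move=> x y; rewrite gal_add sN.
Qed.

HB.instance Definition _ := GRing.isZmodMorphism.Build E E (gal_fun s)
  gal_is_zmod_morphism.

Lemma gal_is_monoid_morphism : monoid_morphism s.
Proof.
split; last exact: gal_mul.
have s1 : s 1 != 0.
  apply/eqP => h; have := bij_inj (gal_bij s) (etrans h (esym (raddf0 (gal_fun s)))).
  by move/eqP; rewrite oner_eq0.
by apply: (mulIf s1); rewrite -gal_mul !mul1r.
Qed.

HB.instance Definition _ := GRing.isMonoidMorphism.Build E E (gal_fun s)
  gal_is_monoid_morphism.

End GalMorphism.

Section AperyField.
Variables (p : nat) (p_prime : prime p).
Local Notation F := 'F_p.
Local Notation L := (laurent F).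
Local Notation A := (aperyp p).

Definition poly_laurent (a : {poly F}) : L := FracField.tofrac (poly_ps a).

Lemma poly_laurent_is_zmod_morphism : zmod_morphism poly_laurent.
Proof. by move=> a b; rewrite /poly_laurent !rmorphB. Qed.

Lemma poly_laurent_is_monoid_morphism : monoid_morphism poly_laurent.
Proof. by split=> [|a b]; rewrite /poly_laurent ?rmorph1 ?rmorphM. Qed.

HB.instance Definition _ := GRing.isZmodMorphism.Build {poly F} L
  poly_laurent poly_laurent_is_zmod_morphism.
HB.instance Definition _ := GRing.isMonoidMorphism.Build {poly F} L
  poly_laurent poly_laurent_is_monoid_morphism.

Lemma poly_laurent_inj : injective poly_laurent.
Proof. by move=> a b /eqP; rewrite tofrac_eq => /eqP /poly_ps_inj. Qed.

Lemma poly_laurent_eq0 a : (poly_laurent a == 0) = (a == 0).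
Proof. by rewrite -(rmorph0 poly_laurent) (inj_eq poly_laurent_inj). Qed.

Lemma poly_laurentC e : poly_laurent e%:P = Fpt_const e.
Proof. by rewrite /poly_laurent poly_psC. Qed.

Lemma poly_laurent_Fpt a : poly_laurent a \in @Fpt p.
Proof.
rewrite -[a]coefK poly_def rmorph_sum rpred_sum// => i _.
rewrite -mul_polyC rmorphM rmorphXn /= poly_laurentC rpredM ?rpredX//.
  by apply: sub_gen_subfield; right; exists a`_i.
by apply: sub_gen_subfield; left; rewrite /= /poly_laurent poly_psX.
Qed.

Lemma FptP (x : L) : x \in @Fpt p ->
  exists a b, b != 0 /\ x = poly_laurent a / poly_laurent b.
Proof.
move=> /asboolP xK.
pose S : {pred L} := fun x =>
  `[< exists a b : {poly F}, b != 0 /\ x = poly_laurent a / poly_laurent b >].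
suff /asboolP : x \in S by [].
have poly_S a : poly_laurent a \in S.
  by apply/asboolP; exists a, 1; rewrite oner_neq0 rmorph1 divr1.
apply: xK => [|_ [->|[e ->]]]; last 2 first.
- by have := poly_S 'X; rewrite /poly_laurent poly_psX.
- by rewrite -poly_laurentC.
split=> [|_ _ /asboolP[a [b [b0 ->]]] /asboolP[a' [b' [b'0 ->]]]
  |_ _ /asboolP[a [b [b0 ->]]] /asboolP[a' [b' [b'0 ->]]]].
- by rewrite -(rmorph1 poly_laurent).
- apply/asboolP; exists (a * b' - a' * b), (b * b'); rewrite mulf_neq0//; split=> //.
  by rewrite rmorphB !rmorphM /= -[- (_ / _)]mulNr addf_div ?poly_laurent_eq0// mulNr.
have [->|a'0] := eqVneq a' 0.
  by rewrite rmorph0 mul0r invr0 mulr0 -(rmorph0 poly_laurent).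
apply/asboolP; exists (a * b'), (b * a'); rewrite mulf_neq0//; split=> //.
by rewrite !rmorphM invf_div mulf_div.
Qed.

Let f : L := ps_laurent (apery_series p).

Let f_kummer : poly_laurent A * f ^+ p.-1 = 1.
Proof.
rewrite /f /ps_laurent /poly_laurent -rmorphXn -rmorphM.
by rewrite (apery_ps_kummer p_prime) rmorph1.
Qed.

Let f_neq0 : f != 0.
Proof.
apply/eqP => f0; have := f_kummer; rewrite f0 expr0n.
have -> : (p.-1 == 0)%N = false by have := prime_gt1 p_prime; case: (p) => [|[]].
by rewrite mulr0 => /esym/eqP; rewrite oner_eq0.
Qed.

Let f_pred : f ^+ p.-1 = (poly_laurent A)^-1.
Proof.
have A0 : poly_laurent A != 0.
  by apply/eqP => A0; have := f_kummer; rewrite A0 mul0r => /esym/eqP; rewrite oner_eq0.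
by apply: (mulfI A0); rewrite f_kummer mulfV.
Qed.

Let p1 : (0 < p.-1)%N.
Proof. by have := prime_gt1 p_prime; case: (p) => [|[]]. Qed.

Lemma aperyp_pred_Fpt : f ^+ p.-1 \in @Fpt p.
Proof. by rewrite f_pred rpredV poly_laurent_Fpt. Qed.

(** Bezout replaces [d] by [d' = gcdn d p.-1]. Then [A] is the [e]-th power of a rational function
    with [e = (p - 1) / d'], and its base is a polynomial since [y ^+ e] dividing [x ^+ e] forces
    [y] to divide [x]. *)
Lemma aperyp_exp_Fpt d : (0 < d)%N -> f ^+ d \in @Fpt p ->
  exists e g, A = g ^+ e /\ (p.-1 <= e * d)%N.
Proof.
move=> d0 fd; set d' := gcdn d p.-1.
have d'0 : (0 < d')%N by rewrite gcdn_gt0 d0.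
have f_p := aperyp_pred_Fpt.
have fd' : f ^+ d' \in @Fpt p.
  have [u v uv _] := egcdnP p.-1 d0.
  have -> : f ^+ d' = (f ^+ d) ^+ u / (f ^+ p.-1) ^+ v.
    rewrite -!exprM [(d * u)%N]mulnC uv exprD [(v * _)%N]mulnC mulrAC divff ?mul1r//.
    by rewrite expf_neq0.
  by rewrite rpred_div// rpredX.
have /dvdnP[e pe] : (d' %| p.-1)%N by exact: dvdn_gcdr.
have e0 : (0 < e)%N by move: p1; rewrite pe muln_gt0 => /andP[].
have [x [y [y0 xy]]] := FptP (rpredVr fd').
have y0' : poly_laurent y != 0 by rewrite poly_laurent_eq0.
have xye : x ^+ e = A * y ^+ e.
  apply: poly_laurent_inj; rewrite rmorphM !rmorphXn /=.
  rewrite -[poly_laurent x](divfK y0') -xy exprMn; congr (_ * _).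
  by rewrite exprVn -exprM mulnC -pe f_pred invrK.
have /dvdpP[g xg] : y %| x by rewrite -(dvdp_pexp2r y x e0) xye dvdp_mull.
exists e, g; split; last by rewrite pe leq_mul// dvdn_leq// dvdn_gcdl.
apply: (mulIf (_ : y ^+ e != 0)); first by rewrite expf_neq0.
by rewrite -xye xg exprMn.
Qed.

(** The square of [B f^((p-1)/2)] is [A f^(p-1) = 1], so this product is a sign. *)
Lemma aperyp_sqr_Fpt (B : {poly F}) :
  p.-1 = (2 * p./2)%N -> A = B ^+ 2 -> f ^+ p./2 \in @Fpt p.
Proof.
move=> ph AB; set w := poly_laurent B * f ^+ p./2.
have : w ^+ 2 == 1 by rewrite /w exprMn -exprM mulnC -ph -rmorphXn -AB f_kummer.
have B0 : poly_laurent B != 0.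
  rewrite poly_laurent_eq0; apply: contra_eq_neq AB => ->.
  by rewrite expr0n /= -size_poly_gt0 size_aperyp// prime_gt0.
have -> : f ^+ p./2 = w / poly_laurent B by rewrite /w mulrC mulKf.
rewrite sqrf_eq1 => /orP[] /eqP ->.
  by rewrite rpred_div ?rpred1 ?poly_laurent_Fpt.
by rewrite rpred_div ?rpredN ?rpred1 ?poly_laurent_Fpt.
Qed.

Let K : fieldType := gen_subfield_type (Fpt_gens (p := p)).
Let iK : {rmorphism K -> L} := \val.
Let E : fieldType := Fptf p.
Let iE : {rmorphism E -> L} := \val.

Let iKP (k : K) : iK k \in @Fpt p := gen_valP k.

Let const_K (e : F) : K :=
  GenSubfield (sub_gen_subfield (or_intror (ex_intro _ e erefl) : Fpt_gens (Fpt_const e))).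

Let const_K_zmod : zmod_morphism const_K.
Proof. by move=> a b; apply: val_inj; rewrite /= -!poly_laurentC polyCB rmorphB. Qed.

Let const_K_monoid : monoid_morphism const_K.
Proof.
split=> [|a b]; apply: val_inj; rewrite /= -!poly_laurentC ?polyC1 ?rmorph1//.
by rewrite polyCM rmorphM.
Qed.

HB.instance Definition _ := GRing.isZmodMorphism.Build F K const_K const_K_zmod.
HB.instance Definition _ := GRing.isMonoidMorphism.Build F K const_K const_K_monoid.

Let cardF : #|F|.-1 = p.-1.
Proof. by rewrite card_Fp. Qed.

Let b : K := GenSubfield (poly_laurent_Fpt A : poly_laurent A \in gen_subfield _).

Let f_pred_K : iK b^-1 = f ^+ #|F|.-1.
Proof. by rewrite cardF f_pred fmorphV. Qed.

Let sub_Fptf (x : L) : x \in @Fpt p -> x \in gen_subfield (Fptf_gens (p := p)).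
Proof. by move=> xK; apply: sub_gen_subfield; left. Qed.

Let incl (k : K) : E := GenSubfield (sub_Fptf (iKP k)).

Let gal_incl (s : apery_gal p) k : s (incl k) = incl k.
Proof. by apply: gal_fix; exact: iKP. Qed.

(** An automorphism fixes [f^(p-1)], which lies in the base field, so it multiplies [f] by a root of
    unity from the prime field. *)
Lemma apery_gal_unit (s : apery_gal p) :
  exists u : {unit F}, iE (s (f_alpha p)) = Fpt_const (val u) * f.
Proof.
have [|u] := @expn_eq_unit F L (iK \o const_K) (iE (s (f_alpha p))) f f_neq0; last by exists u.
have fN : f_alpha p ^+ #|F|.-1 = incl b^-1.
  by apply: val_inj; rewrite [LHS](rmorphXn iE); exact: esym f_pred_K.
transitivity (iE (s (f_alpha p ^+ #|F|.-1))); first by rewrite !rmorphXn.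
by rewrite fN gal_incl; exact: f_pred_K.
Qed.

Definition apery_char (s : apery_gal p) : {unit F} := projT1 (cid (apery_gal_unit s)).

Lemma apery_charP (s : apery_gal p) :
  iE (s (f_alpha p)) = Fpt_const (val (apery_char s)) * f.
Proof. by rewrite /apery_char; case: cid. Qed.

Lemma apery_char_val (s : apery_gal p) :
  gen_val (s (f_alpha p) / f_alpha p) = Fpt_const (val (apery_char s)).
Proof.
have e : iE (s (f_alpha p) / f_alpha p) = iE (s (f_alpha p)) / iE (f_alpha p).
  exact: fmorph_div.
have fE : iE (f_alpha p) = f by [].
have vE (x : E) : gen_val x = iE x by [].
by rewrite vE e apery_charP fE (mulfK f_neq0).
Qed.

Lemma Fpt_const_inj : injective (@Fpt_const p).
Proof. by move=> x y; rewrite -!poly_laurentC => /poly_laurent_inj /polyC_inj. Qed.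

Lemma apery_char_eq (s : apery_gal p) u :
  iE (s (f_alpha p)) = Fpt_const (val u) * f -> apery_char s = u.
Proof.
by rewrite apery_charP => /(mulIf f_neq0) /Fpt_const_inj /val_inj.
Qed.

Lemma apery_charM : {morph apery_char : s t / (s * t)%g}.
Proof.
move=> s t; apply: apery_char_eq.
have tE : t (f_alpha p) = incl (const_K (val (apery_char t))) * f_alpha p.
  by apply: val_inj; rewrite [LHS]apery_charP [RHS](rmorphM iE).
rewrite /= tE gal_mul gal_incl [LHS](rmorphM iE) [iE (s _)]apery_charP.
rewrite mulrA; congr (_ * _); rewrite -!poly_laurentC polyCM rmorphM mulrC.
by rewrite [iE _]/= -poly_laurentC.
Qed.

(** The elements on which two automorphisms agree form a subfield containing the generators. *)
Lemma apery_char_inj : injective apery_char.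
Proof.
move=> s t st; apply: galP => x.
pose S : {pred L} := fun y => `[< exists z : E, iE z = y /\ s z = t z >].
suff /asboolP[z [zx zst]] : iE x \in S by rewrite -(val_inj zx).
have /asboolP := gen_valP x; apply.
  split=> [|_ _ /asboolP[z [<- zst]] /asboolP[z' [<- zst']]
    |_ _ /asboolP[z [<- zst]] /asboolP[z' [<- zst']]].
  - by apply/asboolP; exists 1; rewrite rmorph1 !(rmorph1 (gal_fun _)).
  - by apply/asboolP; exists (z - z'); split; [exact: (rmorphB iE) |
      rewrite [LHS]rmorphB [RHS]rmorphB; congr (_ - _)].
  by apply/asboolP; exists (z / z'); split; [exact: (fmorph_div iE) |
    rewrite [LHS]fmorph_div [RHS]fmorph_div; congr (_ / _)].
move=> y [yK|->]; apply/asboolP.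
  exists (GenSubfield (sub_Fptf yK)); split=> //.
  by rewrite !gal_fix.
exists (f_alpha p); split=> //; apply: val_inj.
by rewrite [LHS]apery_charP [RHS]apery_charP st.
Qed.

(** * The image of the character as a group of [n]-th roots of unity *)

Section Surjectivity.
Variables (n : nat) (n0 : (0 < n)%N) (fn : f ^+ n \in @Fpt p).
Hypothesis n_min : forall d, (0 < d)%N -> f ^+ d \in @Fpt p -> (n <= d)%N.
Local Notation ev q x := ((map_poly iK q).[x]).

Let a : K := GenSubfield (fn : f ^+ n \in gen_subfield _).

Let n_minK d k : (0 < d)%N -> iK k = f ^+ d -> (n <= d)%N.
Proof. by move=> d0 kd; apply: n_min => //; rewrite -kd; exact: iKP. Qed.

Let ev_conj (q q' : {poly K}) (u : F) : u ^+ n = 1 -> ev q f = ev q' f ->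
  ev q (Fpt_const u * f) = ev q' (Fpt_const u * f).
Proof.
move=> un /eqP; rewrite -subr_eq0 => /eqP qq'; apply/eqP; rewrite -subr_eq0; apply/eqP.
rewrite -hornerN -hornerD -rmorphB.
apply: (@kummer_conj F K L const_K iK f n f_neq0 n0 a b^-1 erefl f_pred_K n_minK).
  by rewrite exprMn -poly_laurentC -rmorphXn -polyC_exp un rmorph1 mul1r.
by rewrite rmorphB hornerD hornerN.
Qed.

Let evP (x : E) : exists q : {poly K}, iE x = ev q f.
Proof.
pose S : {pred L} := fun y => `[< exists q : {poly K}, y = ev q f >].
suff /asboolP : iE x \in S by [].
have /asboolP := gen_valP x; apply.
  split=> [|_ _ /asboolP[q ->] /asboolP[q' ->]|_ _ /asboolP[q ->] /asboolP[q' ->]]; apply/asboolP.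
  - by exists 1; rewrite rmorph1 hornerC.
  - by exists (q - q'); rewrite rmorphB hornerD hornerN.
  have [w we] := @kummer_inv F K L const_K iK f n f_neq0 n0 a b^-1 erefl f_pred_K n_minK q'.
  by exists (q * w); rewrite rmorphM hornerM we.
move=> y [yK|->]; apply/asboolP.
  by exists (GenSubfield yK)%:P; rewrite map_polyC hornerC.
by exists 'X; rewrite map_polyX hornerX.
Qed.

Let ev_mem (q : {poly K}) (u : F) : ev q (Fpt_const u * f) \in gen_subfield (Fptf_gens (p := p)).
Proof.
have fE : f \in gen_subfield (Fptf_gens (p := p)) by apply: sub_gen_subfield; right.
have uE : Fpt_const u \in gen_subfield (Fptf_gens (p := p)).
  by apply: sub_Fptf; rewrite -poly_laurentC poly_laurent_Fpt.
apply: rpred_horner; last by rewrite rpredM.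
by apply/polyOverP => j; rewrite coef_map; apply: sub_Fptf; exact: iKP.
Qed.

(** The automorphism sending [f] to [u f], defined on a chosen polynomial expression of [x] in [f];
    [twistE] gives independence of the choice when [u ^+ n = 1]. *)
Let twist (u : F) (x : E) : E := GenSubfield (ev_mem (projT1 (cid (evP x))) u).

Let twistE u x q : u ^+ n = 1 -> iE x = ev q f -> iE (twist u x) = ev q (Fpt_const u * f).
Proof.
move=> un xq; rewrite /twist /=; case: cid => q' /= xq'.
by apply: ev_conj => //; rewrite -xq.
Qed.

Let ev_scale (q : {poly K}) u y :
  ev (q \Po ((const_K u)%:P * 'X)) y = ev q (Fpt_const u * y).
Proof. exact: (horner_map_scale iK). Qed.

Let twistK u v : u ^+ n = 1 -> v ^+ n = 1 -> u * v = 1 -> cancel (twist u) (twist v).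
Proof.
move=> un vn uv x; have [q xq] := evP x; apply: (val_inj (sT := _)).
have xu := twistE un xq.
have e : iE (twist u x) = ev (q \Po ((const_K u)%:P * 'X)) f.
  by rewrite xu ev_scale.
rewrite [LHS](twistE vn e) ev_scale [RHS]xq mulrA -!poly_laurentC.
by rewrite -rmorphM -polyCM uv rmorph1 mul1r.
Qed.

Lemma apery_char_surj (u : {unit F}) : val u ^+ n = 1 ->
  exists s : apery_gal p, apery_char s = u.
Proof.
move=> un; have u0 : val u != 0 by rewrite -unitfE; exact: valP.
have vn : (val u)^-1 ^+ n = 1 by rewrite exprVn un invr1.
have tD : {morph twist (val u) : x y / x + y}.
  move=> x y; have [q xq] := evP x; have [r yr] := evP y.
  have xy : iE (x + y) = ev (q + r) f by rewrite rmorphD xq yr rmorphD hornerD.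
  apply: val_inj; rewrite [LHS](twistE un xy) [RHS](rmorphD iE).
  by rewrite (twistE un xq) (twistE un yr) rmorphD hornerD.
have tM : {morph twist (val u) : x y / x * y}.
  move=> x y; have [q xq] := evP x; have [r yr] := evP y.
  have xy : iE (x * y) = ev (q * r) f by rewrite rmorphM xq yr rmorphM hornerM.
  apply: val_inj; rewrite [LHS](twistE un xy) [RHS](rmorphM iE).
  by rewrite (twistE un xq) (twistE un yr) rmorphM hornerM.
have tB : bijective (twist (val u)).
  by exists (twist (val u)^-1); apply: twistK; rewrite ?mulfV ?mulVf.
have tF : {in Fpt_in_Fptf (p := p), forall x, twist (val u) x = x}.
  move=> x xK; pose k : K := GenSubfield (xK : iE x \in gen_subfield _).
  have xk : iE x = ev k%:P f by rewrite map_polyC hornerC.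
  by apply: val_inj; rewrite [LHS](twistE un xk) map_polyC hornerC.
exists (Gal tD tM tB tF); apply: apery_char_eq => /=.
have fX : iE (f_alpha p) = ev 'X f by rewrite map_polyX hornerX.
by rewrite [LHS](twistE un fX) map_polyX hornerX.
Qed.

Lemma apery_char_expn (s : apery_gal p) : val (apery_char s) ^+ n = 1.
Proof.
have : s (f_alpha p ^+ n) = f_alpha p ^+ n.
  have -> : f_alpha p ^+ n = incl a by apply: val_inj; exact: (rmorphXn iE).
  exact: gal_incl.
rewrite rmorphXn => /(congr1 iE); rewrite !rmorphXn apery_charP exprMn.
move=> /eqP; rewrite -[X in _ == X]mul1r => /eqP /(mulIf (expf_neq0 _ f_neq0)) e.
by apply: Fpt_const_inj; rewrite -[RHS]poly_laurentC rmorph1 -e -!poly_laurentC polyC_exp rmorphXn.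
Qed.

End Surjectivity.

End AperyField.

HB.instance Definition _ (p : nat) (p_prime : prime p) :=
  isMultiplicative.Build (apery_gal p) {unit 'F_p} (apery_char p_prime)
    (apery_charM p_prime).

(** * Euler's criterion and the two images *)

(** For a generator [g] of the cyclic group of order [2 h], [g^(k h) = 1] forces [k] to be even. *)
Lemma unit_sqr_euler (F : finFieldType) h (u : {unit F}) :
  #|F|.-1 = (2 * h)%N -> val u ^+ h = 1 -> exists v : {unit F}, u = (v ^+ 2)%g.
Proof.
move=> Fh uh; have h0 : (0 < h)%N.
  by have := finNzRing_gt1 F; rewrite -ltn_predRL Fh muln_gt0.
have /cyclicP[g gE] := field_unit_group_cyclic [set: {unit F}]%G.
have og : #[g]%g = (2 * h)%N by rewrite orderE -gE card_finField_unit.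
have /cycleP[k uk] : u \in <[g]>%g by rewrite -gE inE.
have : (g ^+ (k * h))%g = 1%g.
  by apply: val_inj; rewrite expgM -uk FinRing.val_unitX.
move=> /eqP; rewrite -order_dvdn og dvdn_pmul2r// => /dvdnP[j kj].
by exists (g ^+ j)%g; rewrite uk kj expgM.
Qed.

Theorem theorem1 (p : nat) (p_prime : prime p)
    (p_mod24 : (p %% 24)%N \in [:: 1; 5; 7; 11; 13; 17; 19; 23]%N) :
  exists chi : {multiplicative apery_gal p -> {unit 'F_p}},
    [/\ forall s : apery_gal p,
          gen_val (s (f_alpha p) / f_alpha p) = Fpt_const (val (chi s)),
        injective chi,
        (p %% 24)%N \in [:: 1; 5; 7; 11]%N ->
          range chi = [set u | exists v : {unit 'F_p}, u = (v ^+ 2)%g]%classic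
      & (p %% 24)%N \in [:: 13; 17; 19; 23]%N ->
          range chi = [set: {unit 'F_p}]%classic].
Proof.
have p3 := mod24_gt3 p_prime p_mod24.
have ph : p.-1 = (2 * p./2)%N := congr1 predn (odd_prime_halfE p_prime (ltnW p3)).
have h0 : (0 < p./2)%N by rewrite half_gt0 (ltn_trans _ p3).
have cardF : #|{: 'F_p}|.-1 = p.-1 by rewrite card_Fp.
exists (apery_char p_prime); split.
- exact: apery_char_val.
- exact: apery_char_inj.
- move=> pr; have [B AB] := aperyp_is_sqr p_prime pr.
  have fh := aperyp_sqr_Fpt p_prime ph AB.
  (* Here [A] is an [e]-th power with [p - 1 <= e d] and [e <= 2], so [(p - 1) / 2] is the least
     exponent and the image consists of its roots of unity, the squares. *)
  have h_min d : (0 < d)%N -> ps_laurent (apery_series p) ^+ d \in @Fpt p -> (p./2 <= d)%N.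
    move=> d0 /(aperyp_exp_Fpt p_prime d0)[e [g [Ag ed]]].
    have e2 := aperyp_eq_exp p_prime p3 Ag.
    by rewrite -(leq_pmul2l (ltn0Sn 1)) -ph (leq_trans ed)// leq_mul2r e2 orbT.
  apply/seteqP; split=> [u [s _ <-]|_ [v ->]] /=.
    by apply: (@unit_sqr_euler _ p./2); [rewrite cardF | exact: apery_char_expn].
  have [|s su] := apery_char_surj p_prime h0 fh h_min (u := (v ^+ 2)%g); last by exists s.
  by rewrite FinRing.val_unitX -exprM -ph -cardF unit_exp_card.
move=> pr; have f1 : ps_laurent (apery_series p) ^+ p.-1 \in @Fpt p.
  by rewrite (aperyp_pred_Fpt p_prime).
have p1 : (0 < p.-1)%N by rewrite ph muln_gt0.
(* Now [e = 2] is excluded as well, because [A] is not a square. *)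
have p_min d : (0 < d)%N -> ps_laurent (apery_series p) ^+ d \in @Fpt p -> (p.-1 <= d)%N.
  move=> d0 /(aperyp_exp_Fpt p_prime d0)[e [g [Ag ed]]].
  have := aperyp_eq_exp p_prime p3 Ag; rewrite leq_eqVlt => /orP[/eqP e2|e1].
    by move: Ag; rewrite e2 => /(aperyp_not_sqr p_prime pr).
  by rewrite (leq_trans ed)// -[X in (_ <= X)%N]mul1n leq_mul2r -ltnS e1 orbT.
apply/seteqP; split=> // u _; have [|s su] := apery_char_surj p_prime p1 f1 p_min (u := u).
  by rewrite -cardF unit_exp_card.
by exists s.
Qed.
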